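(* Let $\mathcal{H}\subseteq\{0,1\}^X$ be a hypothesis class. The following are equivalent: (1) $\mathcal{H}$ is PEC learnable in a stable fashion; (2) $\mathcal{H}$ does not shatter arbitrarily large finite Littlestone trees (i.e. there is a finite bound on the depths of the complete binary mistake trees shattered by $\mathcal{H}$; equivalently, $\mathcal{H}$ is a Littlestone class). Moreover, whenever $\mathcal{H}$ satisfies these conditions, the SOA is a PEC learner for $\mathcal{H}$ that makes at most $d=\mathrm{Ldim}(\mathcal{H})$ mind changes, i.e. it changes its output hypothesis at most $d$ times on every countably infinite realizable sequence $(x_1,y_1),(x_2,y_2),\ldots$ (one in which every finite prefix is consistent with some $h\in\mathcal{H}$).
   Context: Standing measurability assumption: either $X$ is countable with the power set as $\sigma$-algebra, or $X$ is a Polish space with its Borel $\sigma$-algebra and there are a Polish space $\Theta$ and a Borel map $\mathtt{h}:\Theta\times X\to\{0,1\}$ with $\mathcal{H}=\{\mathtt{h}(\theta,\cdot):\theta\in\Theta\}$. A hypothesis is a function $X\to\{0,1\}$. A learning rule is a map $\mathcal{A}:\bigcup_{n\ge 0}(X\times\{0,1\})^n\to\{0,1\}^X$. For a probability distribution $D$ on $X\times\{0,1\}$, $L_D(h)=\Pr_{(x,y)\sim D}[h(x)\ne y]$; $D$ is realizable by $\mathcal{H}$ if $\inf_{h\in\mathcal{H}}L_D(h)=0$. PEC learning: $\mathcal{A}$ is a PEC (Probably Eventually Correct) learner for $\mathcal{H}$ if for every distribution $D$ realizable by $\mathcal{H}$, $\Pr[(\exists N)(\forall n\ge N): L_D(h_n)=0]=1$,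 where the probability is over an infinite i.i.d. sequence $z_1,z_2,\ldots$ drawn from $D$ and $h_n=\mathcal{A}(z_1,\ldots,z_n)$. $\mathcal{H}$ is PEC learnable in a stable fashion if there exist a PEC learner $\mathcal{A}$ for $\mathcal{H}$ and $d\in\mathbb{N}$, not depending on $D$, such that for every realizable $D$ also $\Pr[\,|\{n: h_n\ne h_{n+1}\}|\le d\,]=1$. Littlestone dimension: a mistake tree (Littlestone tree) of depth $t$ is a complete binary decision tree of depth $t$ whose internal nodes are labeled by elements of $X$. A root-to-leaf path gives a sequence $(x_i,y_i)_{i=1}^t$, where $x_i$ is the label of the $i$-th node and $y_i\in\{0,1\}$ is the direction of the next step. The tree is shattered by $\mathcal{H}$ if for every root-to-leaf path there is $h\in\mathcal{H}$ with $h(x_i)=y_i$ for all $i$. $\mathrm{Ldim}(\mathcal{H})$ is the supremum of depths of trees shattered by $\mathcal{H}$; $\mathcal{H}$ is a Littlestone class if this is finite. By convention the empty class has smaller dimension than every nonempty class. SOA (standard optimal algorithm): for a finite set $S$ of labeled examples let $\mathcal{H}_S=\{h\in\mathcal{H}: h(x)=y \text{ for all }(x,y)\in S\}$, and let $\mathrm{SOA}(S)$ be the hypothesis assigning to each $x\in X$ the value $y_x\in\{0,1\}$ maximizing $\mathrm{Ldim}(\mathcal{H}_{S\cup\{(x,y_x)\}})$, with $y_x=1$ in case of ties. As a learning rule, the SOA is lazy: it processes the examples sequentially, starting with $S'=\emptyset$ and $h_0=\mathrm{SOA}(\emptyset)$; if $h_n(x_{n+1})=y_{n+1}$ then $h_{n+1}=h_n$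 and $S'$ is unchanged, and otherwise $(x_{n+1},y_{n+1})$ is added to $S'$ and $h_{n+1}=\mathrm{SOA}(S')$. *)

(* Defs.v *)
From HB Require Import structures.
From mathcomp Require Import all_boot all_order all_algebra.
From mathcomp Require Import all_classical all_reals all_analysis.

Set Implicit Arguments.
Unset Strict Implicit.
Unset Printing Implicit Defensive.

Import Order.TTheory GRing.Theory Num.Theory.

Local Open Scope classical_set_scope.
Local Open Scope ring_scope.
Local Open Scope ereal_scope.

Definition consistent (X : Type) (h : X -> bool) (s : seq (X * bool)) : bool :=
  all (fun z => h z.1 == z.2) s.

Inductive mistake_tree (X : Type) : nat -> Type :=
| mt_leaf : mistake_tree X 0
| mt_node t : X -> (bool -> mistake_tree X t) -> mistake_tree X t.+1.

(* Labelled examples met when following the directions [b] from the root; [b]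
   is only used at the depth of the tree, so that [b] selects a leaf. *)
Fixpoint branch (X : Type) (t : nat) (T : mistake_tree X t) (b : seq bool) :
    seq (X * bool) :=
  match T, b with
  | mt_node _ x sub, y :: b' => (x, y) :: branch (sub y) b'
  | _, _ => [::]
  end.

Definition shattered (X : Type) (H : set (X -> bool)) (t : nat)
    (T : mistake_tree X t) : Prop :=
  forall b : t.-tuple bool, exists2 h, H h & consistent h (branch T b).

Definition shatters_depth (X : Type) (H : set (X -> bool)) (t : nat) : Prop :=
  exists T : mistake_tree X t, shattered H T.

(* As [ereal_sup set0 = -oo], the empty class lies strictly below all the
   nonempty ones, whose dimension is at least 0 because of the one-leaf tree. *)
Definition Ldim (R : realType) (X : Type) (H : set (X -> bool)) : \bar R :=
  ereal_sup [set (t%:R)%:E | t in [set t | shatters_depth H t]].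

Definition bounded_trees (X : Type) (H : set (X -> bool)) : Prop :=
  exists n : nat, forall t, shatters_depth H t -> (t <= n)%N.

Definition littlestone_class (R : realType) (X : Type) (H : set (X -> bool)) :
    Prop := Ldim R H < +oo.

Definition version_space (X : Type) (H : set (X -> bool)) (S : seq (X * bool)) :
    set (X -> bool) := [set h | H h /\ consistent h S].

Definition SOA_hyp (R : realType) (X : Type) (H : set (X -> bool))
    (S : seq (X * bool)) : X -> bool := fun x =>
  Ldim R (version_space H (rcons S (x, false)))
    <= Ldim R (version_space H (rcons S (x, true))).

Definition learning_rule (X : Type) := seq (X * bool) -> X -> bool.

(* The set S' of examples on which the lazy SOA erred while reading [s]. *)
Definition SOA_state (R : realType) (X : Type) (H : set (X -> bool))
    (s : seq (X * bool)) : seq (X * bool) :=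
  foldl (fun S z => if SOA_hyp R H S z.1 == z.2 then S else rcons S z) [::] s.

Definition SOA (R : realType) (X : Type) (H : set (X -> bool)) :
    learning_rule X := fun s => SOA_hyp R H (SOA_state R H s).

(* Sequences are indexed from 0: the first n examples of [z] are [mkseq z n]. *)
Definition realizable_seq (X : Type) (H : set (X -> bool))
    (z : nat -> X * bool) : Prop :=
  forall n, exists2 h, H h & consistent h (mkseq z n).

Definition mind_changes (X : Type) (A : learning_rule X)
    (z : nat -> X * bool) : set nat :=
  [set n | A (mkseq z n) <> A (mkseq z n.+1)].

(* Outer measure of the error set.  It is the probability of error whenever the
   error set is measurable, or merely measurable for the completion of D: the
   hypotheses produced by a learner need not be Borel. *)
Definition loss (R : realType) (d : measure_display) (X : measurableType d)
    (D : probability (X * bool)%type R) (h : X -> bool) : \bar R :=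
  (D^*)%mu [set z | h z.1 != z.2].

Definition realizable (R : realType) (d : measure_display)
    (X : measurableType d) (H : set (X -> bool))
    (D : probability (X * bool)%type R) : Prop :=
  ereal_inf [set loss D h | h in H] = 0.

Definition iid (R : realType) (d d' : measure_display) (T : measurableType d)
    (D : probability T R) (Om : measurableType d') (P : probability Om R)
    (Z : nat -> {RV P >-> T}) : Prop :=
  (forall n (B : set T), measurable B -> distribution P (Z n) B = D B) /\
  (forall (J : seq nat) (B : nat -> set T), uniq J ->
     (forall i, measurable (B i)) ->
     P (\bigcap_(i in [set` J]) (Z i @^-1` B i)) =
       \prod_(i <- J) P (Z i @^-1` B i)).

(* "Almost surely" ([ae]) means up to a subset of a null set, i.e. with
   probability 1 for the completed measure. *)
Definition PEC_learner (R : realType) (d : measure_display)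
    (X : measurableType d) (H : set (X -> bool)) (A : learning_rule X) : Prop :=
  forall D : probability (X * bool)%type R, realizable H D ->
  forall (d' : measure_display) (Om : measurableType d') (P : probability Om R)
    (Z : nat -> {RV P >-> (X * bool)%type}), iid D Z ->
  {ae P, forall w, exists N : nat, forall n : nat, (N <= n)%N ->
    loss D (A (mkseq (fun i => Z i w) n)) = 0}.

Definition stably_PEC_learnable (R : realType) (d : measure_display)
    (X : measurableType d) (H : set (X -> bool)) : Prop :=
  exists (A : learning_rule X) (k : nat),
    PEC_learner R H A /\
    forall D : probability (X * bool)%type R, realizable H D ->
    forall (d' : measure_display) (Om : measurableType d')
      (P : probability Om R) (Z : nat -> {RV P >-> (X * bool)%type}), iid D Z ->
    {ae P, forall w, (mind_changes A (fun i => Z i w) #<= `I_k)%card}.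

Definition complete_separable (R : realType) (M : metricType R) : Prop :=
  (forall F : set_system M, ProperFilter F -> cauchy F -> exists x : M, F --> x) /\
  (exists2 S : set M, countable S & dense S).

(* The complete separable metric on [T] is given as the one transported from [M]
   along a bijection [f]: the Borel sets of [T] are the [f @^-1` B] with [B]
   Borel in [M]. *)
Definition polish_borel (R : realType) (d : measure_display)
    (T : measurableType d) : Prop :=
  exists (M : metricType R) (f : T -> M),
    [/\ bijective f, complete_separable M &
        forall A : set T,
          measurable A <-> exists2 B, <<s (@open M) >> B & A = f @^-1` B].

(* The sigma-algebra on [Th * X] is the product one, which for Polish spaces is
   the Borel sigma-algebra of the product.  Measurable types being inhabited,
   the case [H = set0] accounts for the empty parameter space. *)
Definition measurability_assumption (R : realType) (d : measure_display)
    (X : measurableType d) (H : set (X -> bool)) : Prop :=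
  (countable [set: X] /\ forall B : set X, measurable B) \/
  (polish_borel R X /\
   (H = set0 \/
    exists (d' : measure_display) (Th : measurableType d')
      (h : Th * X -> bool),
      [/\ polish_borel R Th, measurable_fun setT h &
          H = range (fun th => fun x => h (th, x))])).

(* Main.v *)
Require Import Defs.
From mathcomp Require Import all_boot all_order all_algebra.
From mathcomp Require Import all_classical all_reals all_analysis.
From mathcomp Require Import measurable_realfun.
From mathcomp Require Import ring.

(** Why the theorem holds.

Combinatorics.  When the SOA errs on [x], the label that it rejected leaves a
version space of no larger dimension than the label that it predicted, so both
labels shatter whatever the rejected one shatters, and the version space before
the mistake shatters trees that are one level deeper
([shatters_SOA_state]).  Hence at most [Ldim H] examples are ever recorded, and
every mind change records one ([mind_changes_SOA]).

The SOA is eventually correct.  Almost every sample is realizable, so from some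
time [N] on the SOA makes no mistake and keeps a hypothesis that is a function of
finitely many of the first [N] draws.  There are countably many ways to choose
the positions of these draws; for each of them, the hypothesis is independent of
the draws after [N], and if its loss were positive the later draws would almost
surely reveal an error ([SOA_hyp_correct_ae]).  Fixing the hypothesis while the
later draws vary is an application of Fubini's theorem, which requires its error
set to be measurable jointly in the sample and the tested example.  This is where
the assumption on the class enters: shattering a tree of fixed depth is a finite
alternation of conjunctions and of existential quantifiers over the Polish spaces
of points and of parameters, hence an analytic condition on the sample
([analytic_projection], [analytic_shatters]).  Analytic sets are measurable for
the completion of every finite measure, by capacitability ([analytic_inner],
[analytic_completion]), and the SOA is a countable Boolean combination of them
([completion_measurable_SOA_error]).  The measurability of each single
hypothesis would not suffice, since sections say nothing about the joint error
set.

Stable learners force bounded trees.  Given a shattered tree, an adversary walks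
down from the root.  At each node it draws from the examples shown so far until
the learner is right on all of them, which must happen because a distribution
supported on these examples is realizable; it then reveals the node with the
label that the current hypothesis gets wrong.  So each level costs the learner
one mind change, along a finite word that has positive probability under the
last distribution ([force_mind_changes], [draw_prefix]), and the bound on mind
changes bounds the depth.  The independent draws from a finite list are obtained
from the digits of a uniform real number ([iid_draw]). *)

Set Implicit Arguments.
Unset Strict Implicit.
Unset Printing Implicit Defensive.

Import Order.TTheory GRing.Theory Num.Theory.

Local Open Scope classical_set_scope.
Local Open Scope ring_scope.

(** * Shattered trees and the Littlestone dimension *)

Section Shattering.
Variable X : Type.
Implicit Types (H V : set (X -> bool)) (S : seq (X * bool)) (t : nat).

Lemma consistent_rcons (h : X -> bool) S z :
  consistent h (rcons S z) = consistent h S && (h z.1 == z.2).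
Proof. by rewrite /consistent all_rcons andbC. Qed.

Lemma version_space_nil H : version_space H [::] = H.
Proof. by apply/seteqP; split=> h //= -[]. Qed.

Lemma version_space_rcons H S x b :
  version_space (version_space H S) [:: (x, b)] = version_space H (rcons S (x, b)).
Proof.
apply/seteqP; split=> h /=; rewrite /version_space /= consistent_rcons /= andbT.
  by move=> [[Hh ->] ->].
by move=> [Hh /andP[-> ->]].
Qed.

Lemma mistake_tree_nodeP t (T : mistake_tree X t.+1) :
  exists x sub, T = mt_node x sub.
Proof.
pose goal n : mistake_tree X n -> Prop :=
  if n is m.+1 then fun T => exists x sub, T = @mt_node X m x sub
  else fun=> True.
suff G n T' : goal n T' by exact: (G _ T).
by case: T' => //= m x sub; exists x, sub.
Qed.

Lemma sub_shatters_depth V1 V2 t :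
  V1 `<=` V2 -> shatters_depth V1 t -> shatters_depth V2 t.
Proof.
by move=> V12 [T shT]; exists T => b; have [h /V12 ? ?] := shT b; exists h.
Qed.

Lemma shatters_depth0 H : shatters_depth H 0 <-> exists h, H h.
Proof.
split=> [[T shT]|[h Hh]]; first by have [h Hh _] := shT [tuple]; exists h.
by exists (mt_leaf X) => b; exists h.
Qed.

(** Trees can be forgotten: shattering to depth [t.+1] is one quantifier over
points on top of two shattering statements of depth [t].  This is the form that
the game against a learner and the measurability argument both recurse on. *)
Lemma shatters_depthS H t : shatters_depth H t.+1 <->
  exists x, forall b, shatters_depth (version_space H [:: (x, b)]) t.
Proof.
split=> [[T shT]|[x shH]].
  have [x [sub eT]] := mistake_tree_nodeP T.
  exists x => y; exists (sub y) => b.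
  have [h Hh] := shT (cons_tuple y b); rewrite eT /= => /andP[hx hb].
  by exists h => //; split=> //; rewrite /consistent /= hx.
have [sub shsub] := choice shH.
exists (mt_node x sub) => b; rewrite (tuple_eta b).
have [h [Hh]] := shsub (thead b) (behead_tuple b).
rewrite /= andbT => hx hb; exists h => //.
by rewrite /consistent /= hx.
Qed.

Lemma shatters_depth_rconsS H S t : shatters_depth (version_space H S) t.+1 <->
  exists x, forall b, shatters_depth (version_space H (rcons S (x, b))) t.
Proof.
rewrite shatters_depthS; split=> -[x sh]; exists x => b; have := sh b;
  by rewrite version_space_rcons.
Qed.

Lemma version_spaceS H S : version_space H S `<=` H.
Proof. by move=> h []. Qed.

Lemma leq_shatters_depth H t' t :
  (t' <= t)%N -> shatters_depth H t -> shatters_depth H t'.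
Proof.
elim: t' t H => [|t' IH] [|t] H // le_t't /shatters_depthS[x sh].
  have /sub_shatters_depth := @version_spaceS H [:: (x, true)].
  move=> /(_ _ (sh true)); elim: t {sh le_t't} H => // t IH H.
  by move=> /shatters_depthS[{}x /(_ true) /(sub_shatters_depth (@version_spaceS _ _)) /IH].
by apply/shatters_depthS; exists x => b; exact: IH (sh b).
Qed.

Variable R : realType.

Lemma littlestone_classP H : littlestone_class R H <-> bounded_trees H.
Proof.
split=> [|[n Hn]].
  rewrite /littlestone_class => Hoo; apply: contrapT => nb.
  have sh n : shatters_depth H n.
    apply: contrapT => nsh; apply: nb; exists n => t sht; rewrite leqNgt.
    by apply/negP => /ltnW/leq_shatters_depth/(_ sht).
  suff : Ldim R H = +oo%E by move=> e; rewrite e ltxx in Hoo.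
  apply/eqyP => A A0.
  apply: (@le_trans _ _ ((Num.truncn A).+1%:R)%:E).
    by rewrite lee_fin ltW// truncnS_gt.
  by apply: ereal_sup_ubound; exists (Num.truncn A).+1; first exact: sh.
apply: (@le_lt_trans _ _ (n%:R)%:E); last exact: ltry.
by apply: ge_ereal_sup => _ [t /Hn tn <-]; rewrite lee_fin ler_nat.
Qed.

Lemma Ldim_fin H : bounded_trees H -> (exists h, H h) ->
  exists2 k : nat, Ldim R H = (k%:R)%:E &
    forall t, shatters_depth H t -> (t <= k)%N.
Proof.
move=> [n Hn] /shatters_depth0 H0.
have ex : exists k, `[< shatters_depth H k >] by exists 0%N; apply/asboolP.
have ub : forall k, `[< shatters_depth H k >] -> (k <= n)%N.
  by move=> k /asboolP/Hn.
case: (ex_maxnP ex ub) => k /asboolP shk maxk.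
have {}maxk t : shatters_depth H t -> (t <= k)%N by move=> ?; apply/maxk/asboolP.
exists k => //; apply/eqP; rewrite eq_le; apply/andP; split.
  by apply: ge_ereal_sup => _ [t /maxk tk <-]; rewrite lee_fin ler_nat.
by apply: ereal_sup_ubound; exists k.
Qed.

(** Shattering is downward closed in the depth, so comparing two suprema amounts
to countably many implications between shattering statements, which is what makes
the SOA measurable in the sample. *)
Lemma le_LdimP V1 V2 : (Ldim R V1 <= Ldim R V2)%E <->
  forall t, shatters_depth V1 t -> shatters_depth V2 t.
Proof.
split=> [leV t sh1|sh12]; last first.
  by apply: ge_ereal_sup => _ [t /sh12 ? <-]; apply: ereal_sup_ubound; exists t.
apply: contrapT => nsh2.
have lt2 s : shatters_depth V2 s -> (s < t)%N.
  by move=> sh2; rewrite ltnNge; apply/negP => /leq_shatters_depth/(_ sh2).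
have : (t%:R%:E <= Ldim R V2)%E.
  by apply: le_trans leV; apply: ereal_sup_ubound; exists t.
case: t sh1 nsh2 lt2 => [|t] sh1 nsh2 lt2.
  suff -> : Ldim R V2 = -oo%E by [].
  rewrite /Ldim [X in _ @` X](_ : _ = set0) ?image_set0 ?ereal_sup0//.
  by apply/seteqP; split=> s //= /lt2.
apply/negP; rewrite -ltNge; apply: (@le_lt_trans _ _ (t%:R)%:E).
  by apply: ge_ereal_sup => _ [s /lt2 st <-]; rewrite lee_fin ler_nat.
by rewrite lte_fin ltr_nat.
Qed.

(** On a mistake, the label that the SOA rejected has the smaller dimension, so
a tree shattered after the mistake is also shattered by the other label. *)
Lemma SOA_hyp_mistake H S x y t : SOA_hyp R H S x != y ->
  shatters_depth (version_space H (rcons S (x, y))) t ->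
  shatters_depth (version_space H (rcons S (x, ~~ y))) t.
Proof.
case: y; rewrite /SOA_hyp.
  by move=> /negbTE/negbT; rewrite eqb_id -ltNge => /ltW/le_LdimP; exact.
by rewrite eqbF_neg negbK => /le_LdimP; exact.
Qed.

Lemma SOA_state_rcons H s z : SOA_state R H (rcons s z) =
  if SOA_hyp R H (SOA_state R H s) z.1 == z.2 then SOA_state R H s
  else rcons (SOA_state R H s) z.
Proof. by rewrite /SOA_state -cats1 foldl_cat. Qed.

End Shattering.

(** * Mind changes of the lazy SOA and of arbitrary learners *)

Section LazySOA.
Variables (R : realType) (X : Type) (H : set (X -> bool)).
Implicit Types (s : seq (X * bool)) (z : nat -> X * bool).

Lemma consistent_SOA_state (h : X -> bool) s :
  consistent h s -> consistent h (SOA_state R H s).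
Proof.
elim/last_ind: s => // s z IH; rewrite SOA_state_rcons consistent_rcons.
move=> /andP[/IH hs hz]; case: ifP => // _.
by rewrite consistent_rcons hs.
Qed.

(** Each recorded mistake splits the version space into two parts that shatter
the same trees, hence it costs one level of the tree that was available. *)
Lemma shatters_SOA_state s t :
  shatters_depth (version_space H (SOA_state R H s)) t ->
  shatters_depth H (t + size (SOA_state R H s)).
Proof.
elim/last_ind: s t => [|s [x y] IH] t.
  by rewrite addn0 version_space_nil.
rewrite SOA_state_rcons; case: ifPn => [_ /IH //|/= mis sh].
rewrite size_rcons -addSnnS; apply: IH; apply/shatters_depth_rconsS.
exists x => b; have [->|nb] := eqVneq b y; first exact: sh.
have -> : b = ~~ y by move: nb; case: (b); case: (y).
exact: SOA_hyp_mistake mis sh.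
Qed.

Lemma size_SOA_state k z n :
  (forall t, shatters_depth H t -> (t <= k)%N) -> realizable_seq H z ->
  (size (SOA_state R H (mkseq z n)) <= k)%N.
Proof.
move=> maxk /(_ n)[h Hh hz]; apply: maxk; rewrite -[X in shatters_depth _ X]add0n.
apply: shatters_SOA_state; apply/shatters_depth0; exists h; split=> //.
exact: consistent_SOA_state.
Qed.

Lemma SOA_state_mkseqS z n :
  SOA_state R H (mkseq z n.+1) = SOA_state R H (mkseq z n) \/
  SOA_state R H (mkseq z n.+1) = rcons (SOA_state R H (mkseq z n)) (z n).
Proof. by rewrite mkseqS SOA_state_rcons; case: ifP => _; [left|right]. Qed.

Lemma size_SOA_state_nondecreasing z :
  {homo (fun n => size (SOA_state R H (mkseq z n))) : m n / (m <= n)%N}.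
Proof.
apply: homo_leq => [//|? ? ?|n]; first exact: leq_trans.
by have [->//|->] := SOA_state_mkseqS z n; rewrite size_rcons.
Qed.

(** A mind change lengthens the list of recorded mistakes, so the length of that
list numbers the mind changes injectively. *)
Lemma mind_changes_SOA k z :
  (forall t, shatters_depth H t -> (t <= k)%N) -> realizable_seq H z ->
  (mind_changes (SOA R H) z #<= `I_k)%card.
Proof.
move=> maxk rz; set f := fun n => size (SOA_state R H (mkseq z n)).
have fS n : mind_changes (SOA R H) z n -> (f n < f n.+1)%N.
  move=> mcn; rewrite /f; have [e|->] := SOA_state_mkseqS z n.
    by case: mcn; rewrite /SOA e.
  by rewrite size_rcons.
apply: (@card_le_trans _ _ _ (f @` mind_changes (SOA R H) z)).
  rewrite (card_le_eqr (inj_card_eq _))// => m n /set_mem /fS mS /set_mem /fS nS.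
  case: (ltngtP m n) => // lt_mn emn.
  - have := size_SOA_state_nondecreasing z lt_mn; rewrite -/(f _) -/(f _) -emn.
    by rewrite leqNgt mS.
  - have := size_SOA_state_nondecreasing z lt_mn; rewrite -/(f _) -/(f _) emn.
    by rewrite leqNgt nS.
apply: subset_card_le => _ [n /fS nS <-] /=; apply: leq_trans nS _.
exact: size_SOA_state.
Qed.

(** The whole past enters the final hypothesis through finitely many positions,
of which there are only countably many choices. *)
Lemma SOA_state_map z n : exists2 I : seq nat, all (ltn^~ n) I &
  SOA_state R H (mkseq z n) = map z I.
Proof.
elim: n => [|n [I ltI eI]]; first by exists [::].
have ltIS : all (ltn^~ n.+1) I by apply: sub_all ltI => i /ltnW.
have [->|->] := SOA_state_mkseqS z n; first by exists I.
exists (rcons I n); rewrite ?map_rcons ?eI// all_rcons ltIS andbT.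
exact: ltnSn.
Qed.

Lemma SOA_eventually k z :
  (forall t, shatters_depth H t -> (t <= k)%N) -> realizable_seq H z ->
  exists N, forall n, (N <= n)%N ->
    SOA_state R H (mkseq z n) = SOA_state R H (mkseq z N) /\
    SOA_hyp R H (SOA_state R H (mkseq z N)) (z n).1 = (z n).2.
Proof.
move=> maxk rz; set f := fun n => size (SOA_state R H (mkseq z n)).
have ex : exists m, `[< exists n, f n = m >] by exists (f 0); apply/asboolP; exists 0.
have ub m : `[< exists n, f n = m >] -> (m <= k)%N.
  by move=> /asboolP[n <-]; exact: size_SOA_state.
case: (ex_maxnP ex ub) => m /asboolP[N fN] maxm; exists N.
have fE n : (N <= n)%N -> f n = m.
  move=> Nn; apply/eqP; rewrite eqn_leq maxm /=; last by apply/asboolP; exists n.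
  by rewrite -fN; exact: size_SOA_state_nondecreasing.
have stE n : (N <= n)%N ->
    SOA_state R H (mkseq z n) = SOA_state R H (mkseq z N).
  elim: n => [|n IH]; first by rewrite leqn0 => /eqP ->.
  rewrite leq_eqVlt => /predU1P[->//|/= Nn].
  have [->|e] := SOA_state_mkseqS z n; first exact: IH.
  by have := fE _ (leqW Nn); rewrite {1}/f e size_rcons -/(f n) (fE n)// => /esym/n_Sn.
move=> n Nn; split; first exact: stE.
have := fE _ (leqW Nn); rewrite /f mkseqS SOA_state_rcons stE//.
by case: eqP => // _; rewrite size_rcons -(stE _ Nn) -/(f n) fE// => /esym/n_Sn.
Qed.

End LazySOA.

Section MindChangeCount.
Variables (X : Type) (A : learning_rule X).

Definition num_changes (s : seq (X * bool)) : nat :=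
  count (fun i => `[< A (take i s) <> A (take i.+1 s) >]) (iota 0 (size s)).

Lemma num_changes_rcons s z : num_changes (rcons s z) =
  (num_changes s + `[< A s <> A (rcons s z) >])%N.
Proof.
rewrite /num_changes size_rcons -[(size s).+1]addn1 iotaD count_cat /= add0n addn0.
rewrite [take (size s).+1 _]take_oversize ?size_rcons//.
rewrite -cats1 take_size_cat//; congr (_ + _)%N.
apply: eq_in_count => i; rewrite mem_iota /= add0n => lt_is.
by rewrite !takel_cat//; exact: ltnW.
Qed.

Lemma leq_num_changes_cat s r : (num_changes s <= num_changes (s ++ r))%N.
Proof.
elim/last_ind: r => [|r z IH]; first by rewrite cats0.
by rewrite -rcons_cat num_changes_rcons (leq_trans IH)// leq_addr.
Qed.

Lemma ltn_num_changes_cat s r :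
  A s <> A (s ++ r) -> (num_changes s < num_changes (s ++ r))%N.
Proof.
elim/last_ind: r => [|r z IH]; first by rewrite cats0.
rewrite -rcons_cat num_changes_rcons => neq.
have [e|/IH lt_s] := pselect (A s = A (s ++ r)); last first.
  by rewrite (leq_trans lt_s)// leq_addr.
by rewrite asboolT ?addn1 ?ltnS ?leq_num_changes_cat// -e.
Qed.

Lemma num_changes_mind_changes k z n :
  (mind_changes A z #<= `I_k)%card -> (num_changes (mkseq z n) <= k)%N.
Proof.
move=> mc_k; rewrite /num_changes size_mkseq -size_filter.
set L := (X in size X).
have mcL i : (i < size L)%N -> mind_changes A z (nth 0%N L i).
  move=> /(mem_nth 0%N); rewrite mem_filter mem_iota /= add0n.
  move=> /andP[/asboolP]; rewrite /mkseq -!map_take !take_iota => + lt_n.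
  by rewrite !(minn_idPl _)//; exact: ltnW.
have injL : {in `I_(size L) &, injective (nth 0%N L)}.
  move=> i j /set_mem /= iL /set_mem /= jL /eqP.
  by rewrite nth_uniq ?filter_uniq ?iota_uniq// => /eqP.
rewrite -card_le_II -(card_le_eql (inj_card_eq injL)).
apply: card_le_trans mc_k; apply: subset_card_le => _ [i /= iL <-].
exact: mcL.
Qed.

End MindChangeCount.

(** * Suslin sets and their projections along Polish spaces *)

(** Continuity on the Baire space with values in a discrete set. *)
Definition locally_const (V : Type) (f : (nat -> nat) -> V) : Prop :=
  forall s, exists m, forall s',
    (forall i, (i < m)%N -> s' i = s i) -> f s' = f s.

Lemma locally_const_cst V (v : V) : locally_const (fun=> v).
Proof. by move=> s; exists 0. Qed.

Lemma locally_const_eval i : locally_const (fun s : nat -> nat => s i).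
Proof. by move=> s; exists i.+1 => s'; exact. Qed.

Lemma locally_const_reindex V (f : (nat -> nat) -> V) (g : nat -> nat) :
  locally_const f -> locally_const (fun s => f (s \o g)).
Proof.
move=> lf s; have [m fm] := lf (s \o g).
exists (\max_(i < m) (g i).+1) => s' ss'; apply: fm => i im /=; apply: ss'.
exact: (@leq_bigmax _ (fun i : 'I_m => (g i).+1) (Ordinal im)).
Qed.

Lemma locally_const_bind U V (h : U -> (nat -> nat) -> V) f :
  (forall u, locally_const (h u)) -> locally_const f ->
  locally_const (fun s => h (f s) s).
Proof.
move=> lh lf s; have [m fm] := lf s; have [n hn] := lh (f s) s.
exists (maxn m n) => s' ss'.
by rewrite fm ?hn// => i im; apply: ss'; rewrite leq_max im ?orbT.
Qed.

Lemma locally_const_comp2 U V W (h : U -> V -> W) f g :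
  locally_const f -> locally_const g -> locally_const (fun s => h (f s) (g s)).
Proof.
move=> lf lg; apply: (locally_const_bind (h := fun u s => h u (g s))) => // u.
apply: (locally_const_bind (h := fun v _ => h u v)) => // v.
exact: locally_const_cst.
Qed.

(** The Suslin operation, with codes in the Baire space; allowing any locally
constant condition instead of one on the prefix of length [n] makes codes easy to
rearrange. *)
Definition suslin (T : Type) (P : set (set T)) (E : set T) : Prop :=
  exists A : nat -> (nat -> nat) -> set T,
    [/\ forall n, locally_const (A n), forall n s, P (A n s) &
        E = [set y | exists s, forall n, A n s y]].

Section Suslin.
Variable T : Type.
Implicit Types (P G : set (set T)) (A B E : set T).

Lemma sub_suslin P : P `<=` suslin P.
Proof.
move=> A PA; exists (fun _ _ => A); split=> // [n|].
  exact: locally_const_cst.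
by apply/seteqP; split=> y /= => [Ay|[_ /(_ 0)//]]; exists (fun=> 0).
Qed.

Lemma suslin_mono P Q : P `<=` Q -> suslin P `<=` suslin Q.
Proof. by move=> PQ _ [A [lA PA ->]]; exists A; split=> // n s; exact/PQ. Qed.

Definition pairn (k n : nat) : nat := pickle (k, n).
Definition unpairn (j : nat) : nat * nat := odflt (0, 0)%N (unpickle j).

Lemma pairnK k n : unpairn (pairn k n) = (k, n).
Proof. by rewrite /unpairn /pairn pickleK. Qed.

Lemma suslin_bigcup P (E : nat -> set T) :
  (forall k, suslin P (E k)) -> suslin P (\bigcup_k E k).
Proof.
move=> /choice[A AP]; exists (fun n s => A (s 0%N) n (s \o succn)); split.
- move=> n; apply: (locally_const_bind (h := fun k s => A k n (s \o succn))).
    by move=> k; apply: locally_const_reindex; have [] := AP k.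
  exact: locally_const_eval.
- by move=> n s; have [_ + _] := AP (s 0%N); exact.
apply/seteqP; split=> y /=.
  move=> [k _]; have [_ _ ->] := AP k => -[s As].
  by exists (fun i => if i is j.+1 then s j else k).
by move=> [s As]; exists (s 0%N) => //; have [_ _ ->] := AP (s 0%N); exists (s \o succn).
Qed.

(** A code for the outer family and codes for countably many of its members are
interleaved into one.  The codes of a member are chosen as a function of the set
itself, so that the conditions stay locally constant. *)
Lemma suslin_idem P : suslin (suslin P) `<=` suslin P.
Proof.
move=> _ [A [lA sA ->]].
have /choice[C CP] B : exists C : nat -> (nat -> nat) -> set T,
    (forall n, locally_const (C n)) /\ (suslin P B ->
    (forall n s, P (C n s)) /\ B = [set y | exists s, forall n, C n s y]).
  have [[C [lC PC eB]]|nB] := pselect (suslin P B); first by exists C.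
  by exists (fun _ _ => set0); split=> [n|/nB//]; exact: locally_const_cst.
pose row k (s : nat -> nat) : nat -> nat := s \o pairn k.
have lrow V k (f : (nat -> nat) -> V) :
  locally_const f -> locally_const (fun s => f (row k s)).
  exact: locally_const_reindex.
exists (fun j s => C (A (unpairn j).1 (row 0%N s)) (unpairn j).2
                     (row (unpairn j).1.+1 s)); split.
- move=> j; apply: (@locally_const_bind (set T) _ (fun B s =>
    C B (unpairn j).2 (row (unpairn j).1.+1 s))) => [B|]; apply: lrow.
  + by have [] := CP B.
  + exact: lA.
- move=> j s; have [_ /(_ (sA _ _))[+ _]] := CP (A (unpairn j).1 (row 0%N s)).
  exact.
apply/seteqP; split=> y /=.
  move=> [s As].
  have /choice[t Ct] n : exists t, forall m, C (A n s) m t y.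
    by have [_ /(_ (sA n s))[_ eA]] := CP (A n s); have := As n; rewrite {1}eA.
  exists (fun j => if (unpairn j).1 is n.+1 then t n (unpairn j).2
                   else s (unpairn j).2) => j.
  set u := fun j => _; have -> : row 0%N u = s.
    by apply/funext => i; rewrite /row /u /= pairnK.
  suff -> : row (unpairn j).1.+1 u = t (unpairn j).1 by exact: Ct.
  by apply/funext => i; rewrite /row /u /= pairnK.
move=> [u Cu]; exists (row 0%N u) => n.
have [_ /(_ (sA _ _))[_ ->]] := CP (A n (row 0%N u)).
by exists (row n.+1 u) => m; have := Cu (pairn n m); rewrite pairnK.
Qed.

Lemma suslin_bigcap P (E : nat -> set T) :
  (forall k, suslin P (E k)) -> suslin P (\bigcap_k E k).
Proof.
move=> sE; apply: suslin_idem; exists (fun k _ => E k); split=> // [k|].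
  exact: locally_const_cst.
apply/seteqP; split=> y /= => [Ey|[_ Ey] k _]; last exact: Ey.
by exists (fun=> 0) => k; exact: Ey.
Qed.

(** Complements of Suslin sets are not Suslin in general, hence the requirement
on both the set and its complement: it defines a sigma-algebra, by which all
Borel sets are reached. *)
Definition bisuslin P : set (set T) := [set E | suslin P E /\ suslin P (~` E)].

Lemma bisuslin_sigma_algebra P :
  suslin P set0 -> suslin P setT -> sigma_algebra setT (bisuslin P).
Proof.
move=> s0 sT; split=> [|A [sA sAC]|E sE].
- by split; rewrite ?setC0.
- by rewrite setTD; split; rewrite ?setCK.
- split; first by apply: suslin_bigcup => k; have [] := sE k.
  by rewrite setC_bigcup; apply: suslin_bigcap => k; have [] := sE k.
Qed.

End Suslin.

Section SuslinMeasurable.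
Context d (Y : measurableType d).
Implicit Types E F : set Y.

Notation analytic := (suslin (@measurable d Y)).

Lemma analyticI E F : analytic E -> analytic F -> analytic (E `&` F).
Proof.
move=> sE sF; rewrite -bigcap2E; apply: suslin_bigcap => -[|[|k]] //=.
exact/sub_suslin.
Qed.

End SuslinMeasurable.

(** What is used of a Polish space: [cl] plays the closed sets and [Bl n] a
countable cover by balls whose radius tends to 0.  The last clause is
completeness, in the form of Cantor's intersection theorem. *)
Definition polish_scheme (T : Type) (cl : set (set T)) (Bl : nat -> nat -> set T)
    : Prop :=
  [/\ cl setT,
      forall C, cl C -> exists2 F : nat -> set T, forall n, cl (F n) &
        ~` C = \bigcup_n F n,
      forall n t, exists i, Bl n i t &
      forall (C : nat -> set T) (tau : nat -> nat), (forall n, cl (C n)) ->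
        (forall n, exists t, forall m, (m <= n)%N -> C m t /\ Bl m (tau m) t) ->
        exists t, forall m, C m t].

Section Projection.
Context d d' (Y : measurableType d) (T : measurableType d').
Variables (cl : set (set T)) (Bl : nat -> nat -> set T).
Hypotheses (clP : polish_scheme cl Bl) (clm : @measurable d' T = <<s cl>>).

Definition boxes : set (set (Y * T)) :=
  [set B | exists A C, [/\ measurable A, cl C & B = A `*` C]].

Lemma boxesX A C : measurable A -> cl C -> boxes (A `*` C).
Proof. by move=> mA clC; exists A, C. Qed.

(** Keeping the second factor closed lets completeness act on the projection. *)
Lemma measurable_suslin_boxes : @measurable _ (Y * T)%type `<=` suslin boxes.
Proof.
have [clT clC _ _] := clP.
have fstP A : measurable A -> boxes (A `*` setT) by move=> mA; exact: boxesX.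
have s0 : suslin boxes set0.
  by apply: sub_suslin; rewrite -(set0X setT); exact: fstP.
have sT : suslin boxes setT.
  by apply: sub_suslin; rewrite -setXTT; exact: fstP.
have W := bisuslin_sigma_algebra s0 sT.
have W1 A : measurable A -> bisuslin boxes (A `*` setT).
  move=> mA; split; first exact/sub_suslin/fstP.
  suff -> : ~` (A `*` setT) = ~` A `*` @setT T.
    by apply/sub_suslin/fstP; exact: measurableC.
  by apply/seteqP; split=> -[y t] /=; tauto.
have W2 B : measurable B -> bisuslin boxes (setT `*` B).
  rewrite clm; move: B; apply: smallest_sub.
    split=> [|B [sB sBC]|E sE].
    - by rewrite setX0; have [] := W.
    - rewrite setTD (_ : _ `*` _ = ~` (setT `*` B)) ?/bisuslin /= ?setCK//.
      by apply/seteqP; split=> -[y t] /=; tauto.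
    - by rewrite setX_bigcupr; have [_ _] := W; apply.
  move=> C clCC; split; first by apply: sub_suslin; exact: boxesX.
  have [F clF FC] := clC C clCC.
  rewrite (_ : ~` _ = \bigcup_n (setT `*` F n)).
    by apply: suslin_bigcup => n; apply: sub_suslin; exact: boxesX.
  rewrite -setX_bigcupr -FC.
  by apply/seteqP; split=> -[y t] /=; tauto.
suff : @measurable _ (Y * T)%type `<=` bisuslin boxes by move=> + A mA => /(_ A mA)[].
rewrite measurable_prod_measurableType; apply: smallest_sub => //.
move=> _ [A mA [B mB <-]].
rewrite (_ : _ `*` _ = (A `*` setT) `&` (setT `*` B)); last first.
  by apply/seteqP; split=> -[y t] /=; tauto.
have [sA sAC] := W1 A mA; have [sB sBC] := W2 B mB; split.
  by rewrite -bigcap2E; apply: suslin_bigcap => -[|[|k]].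
by rewrite setCI -bigcup2E; apply: suslin_bigcup => -[|[|k]].
Qed.

(** A point of [T] is coded by the balls that contain it, and by completeness a
code names a point of all the closed sets as soon as each finite intersection is
inhabited, which is a condition on finitely many coordinates. *)
Lemma analytic_projection (E : set (Y * T)) : suslin measurable E ->
  suslin measurable [set y | exists t, E (y, t)].
Proof.
move=> /(suslin_mono measurable_suslin_boxes)/suslin_idem[B [lB bB ->]].
have [clT clC Blcov Blcap] := clP.
have /choice[AC ACP] (b : set (Y * T)) : exists AC : (set Y * set T)%type,
   [/\ measurable AC.1, cl AC.2 & boxes b -> b = AC.1 `*` AC.2].
  have [[A [C [mA clCC ->]]]|nb] := pselect (boxes b); first by exists (A, C).
  by exists (set0, setT); split=> //=; exact: measurable0.
pose ev (s : nat -> nat) := s \o double.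
pose od (s : nat -> nat) := s \o (succn \o double).
pose A n s := (AC (B n (ev s))).1; pose C n s := (AC (B n (ev s))).2.
have lA n : locally_const (A n).
  apply: (locally_const_bind (h := fun b _ => (AC b).1)) => [b|].
    exact: locally_const_cst.
  exact: locally_const_reindex.
have lC n : locally_const (C n).
  apply: (locally_const_bind (h := fun b _ => (AC b).2)) => [b|].
    exact: locally_const_cst.
  exact: locally_const_reindex.
pose CC n s := [set t | forall m, (m <= n)%N -> C m s t /\ Bl m (od s m) t].
have lCC n : locally_const (CC n).
  have -> : CC n = fun s => \big[setI/setT]_(m < n.+1) (C m s `&` Bl m (od s m)).
    apply/funext => s; rewrite -(bigcap_mkord n.+1 (fun m => C m s `&` Bl m (od s m))).
    by apply/seteqP; split=> t /= Ht m /=; exact: Ht.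
  elim: n.+1 => [|k IH].
    rewrite (_ : (fun _ => _) = fun=> setT); first exact: locally_const_cst.
    by apply/funext => s; rewrite big_ord0.
  rewrite (_ : (fun _ => _) = fun s =>
    \big[setI/setT]_(m < k) (C m s `&` Bl m (od s m)) `&` (C k s `&` Bl k (od s k))).
    apply: locally_const_comp2 => //; apply: locally_const_comp2 => //.
    apply: (locally_const_bind (h := fun i _ => Bl k i)) => [i|].
      exact: locally_const_cst.
    exact: locally_const_eval.
  by apply/funext => s; rewrite big_ord_recr.
exists (fun n s => if pselect (exists t, CC n s t) then A n s else set0); split.
- move=> n; apply: (locally_const_comp2 (fun (D : set T) E =>
    if pselect (exists t, D t) then E else set0)) => //.
- move=> n s; case: pselect => [?|?] /=; last exact: measurable0.
  by have [] := ACP (B n (ev s)).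
apply/seteqP; split=> y /=.
  move=> [t [s Bs]].
  have /choice[tau Htau] n : exists i, Bl n i t by exact: Blcov.
  pose u i := if odd i then tau i./2 else s i./2; exists u => n.
  have evu : ev u = s.
    by apply/funext => i; rewrite /ev /u /= odd_double doubleK.
  have odu : od u = tau.
    by apply/funext => i; rewrite /od /u /= odd_double /= uphalf_double.
  have ACs m : A m u y /\ C m u t.
    have [_ _ /(_ (bB m s)) e] := ACP (B m s).
    by have := Bs m; rewrite {1}e /A /C evu => -[].
  case: pselect => [?|[]] /=; first by have [] := ACs n.
  by exists t => m _; rewrite odu; have [] := ACs m.
move=> [u Hu].
have /Blcap : forall n, cl (C n u) by move=> n; have [] := ACP (B n (ev u)).
move=> /(_ (od u)) [|t Ct].
  by move=> n; have := Hu n; case: pselect.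
exists t, (ev u) => n; have [_ _ ->//] := ACP (B n (ev u)).
split; last exact: Ct.
by have := Hu n; case: pselect.
Qed.

End Projection.

(** * Capacitability and measurability of analytic sets *)

(** Serves both to bound the coordinates of codes one after the other and to
follow an infinite branch of a finitely branching tree. *)
Lemma prefix_choice (Q : seq nat -> Prop) : Q [::] ->
  (forall l, Q l -> exists c, Q (rcons l c)) ->
  exists k : nat -> nat, forall n, Q (mkseq k n).
Proof.
move=> Q0 QS.
have /choice[g gQ] l : exists c, Q l -> Q (rcons l c).
  by have [/QS[c]|nQ] := pselect (Q l); [exists c|exists 0%N].
pose L n := iter n (fun l => rcons l (g l)) [::].
exists (fun n => g (L n)) => n.
have -> : mkseq (fun n => g (L n)) n = L n.
  by elim: n => // n IH; rewrite mkseqS IH.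
by elim: n => //= n /gQ.
Qed.

Lemma exists_invS_lt (R : realType) (e : R) :
  0 < e -> exists n : nat, n.+1%:R^-1 < e.
Proof.
move=> e0; exists (Num.truncn e^-1).
by rewrite invf_plt ?posrE// truncnS_gt.
Qed.

Section OuterMeasure.
Context d (T : measurableType d) (R : realType).
Variable mu : {finite_measure set T -> \bar R}.
Implicit Types (A B E F : set T) (a : \bar R).
Local Open Scope ereal_scope.

Notation outer := (mu^*)%mu.

Lemma le_mu_bigcup_nd (F : (set T)^nat) a : (forall n, measurable (F n)) ->
  {homo F : n m / (n <= m)%N >-> n `<=` m} -> (forall n, mu (F n) <= a) ->
  mu (\bigcup_n F n) <= a.
Proof.
move=> mF ndF Fa.
have Fcvg : mu \o F @ \oo --> mu (\bigcup_n F n).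
  apply: nondecreasing_cvg_mu => //; first exact: bigcupT_measurable.
  by move=> n m nm; apply/subsetPset; exact: ndF.
rewrite -(cvg_lim _ Fcvg)//; apply: lime_le; first by apply/cvg_ex; eexists; exact: Fcvg.
exact: nearW.
Qed.

Lemma ge_mu_bigcap_ni (F : (set T)^nat) a : (forall n, measurable (F n)) ->
  {homo F : n m / (n <= m)%N >-> m `<=` n} -> (forall n, a <= mu (F n)) ->
  a <= mu (\bigcap_n F n).
Proof.
move=> mF niF Fa.
have Fcvg : mu \o F @ \oo --> mu (\bigcap_n F n).
  apply: nonincreasing_cvg_mu => //; last 2 first.
  - exact: bigcapT_measurable.
  - by move=> n m nm; apply/subsetPset; exact: niF.
  by rewrite ltey_eq fin_num_measure.
rewrite -(cvg_lim _ Fcvg)//; apply: lime_ge; first by apply/cvg_ex; eexists; exact: Fcvg.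
exact: nearW.
Qed.

Lemma outer_le_measure A E : measurable A -> E `<=` A -> outer E <= mu A.
Proof. by move=> mA EA; rewrite -measurable_mu_extE//; exact: le_mu_ext. Qed.

Lemma outer_fin_num E : outer E \is a fin_num.
Proof.
rewrite ge0_fin_numE ?mu_ext_ge0//.
apply: (le_lt_trans (outer_le_measure measurableT (subsetT E))).
by rewrite ltey_eq fin_num_measure.
Qed.

Lemma outer_cover E (e : R) : (0 < e)%R ->
  exists B, [/\ measurable B, E `<=` B & mu B < outer E + e%:E].
Proof.
move=> e0; have [x [F [mF EF] <-] xe] := lb_ereal_inf_adherent e0 (outer_fin_num E).
exists (\bigcup_n F n); split=> //; first exact: bigcupT_measurable.
apply: le_lt_trans xe.
by apply: measure_sigma_subadditive => //; exact: bigcupT_measurable.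
Qed.

Lemma outer_hull E : exists B, [/\ measurable B, E `<=` B & mu B = outer E].
Proof.
have /choice[B BP] (n : nat) : exists B,
    [/\ measurable B, E `<=` B & mu B < outer E + (n.+1%:R^-1)%:E].
  by apply: outer_cover; rewrite invr_gt0.
have mB : measurable (\bigcap_n B n).
  by apply: bigcapT_measurable => n; have [] := BP n.
have EB : E `<=` \bigcap_n B n by move=> x Ex n _; have [_ + _] := BP n; exact.
exists (\bigcap_n B n); split=> //; apply/eqP; rewrite eq_le outer_le_measure// andbT.
apply/lee_addgt0Pr => e e0.
have [n ne] := exists_invS_lt e0.
have [mBn _ /ltW lt_n] := BP n.
apply: (@le_trans _ _ (outer E + (n.+1%:R^-1)%:E)).
  by apply: le_trans lt_n; apply: le_measure; rewrite ?inE//; exact: bigcap_inf.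
by rewrite leeD2l// lee_fin ltW.
Qed.

(** Outer measure is continuous along increasing sequences of arbitrary sets:
the hulls can be replaced by the tail intersections, which are increasing. *)
Lemma outer_bigcup_nd (F : (set T)^nat) a :
  {homo F : n m / (n <= m)%N >-> n `<=` m} -> (forall n, outer (F n) <= a) ->
  outer (\bigcup_n F n) <= a.
Proof.
move=> ndF Fa; have /choice[B BP] n := outer_hull (F n).
pose C n := \bigcap_(j in [set j | (n <= j)%N]) B j.
have mC n : measurable (C n).
  by apply: bigcap_measurableType => j _; have [] := BP j.
apply: (@le_trans _ _ (mu (\bigcup_n C n))).
  apply: outer_le_measure; first exact: bigcupT_measurable.
  move=> x [n _ Fx]; exists n => // j /= nj.
  by have [_ + _] := BP j; apply; exact: ndF Fx.
apply: le_mu_bigcup_nd => // [n m nm x Cx j /= mj|n].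
  by apply: Cx => /=; exact: leq_trans mj.
apply: le_trans (Fa n); have [mBn _ <-] := BP n.
by apply: le_measure; rewrite ?inE// => x; apply => /=.
Qed.

(** Capacitability.  Bounding the coordinates of the codes one after the other
loses arbitrarily little outer measure.  Once all of them are bounded, Koenig's
lemma turns the union over codes into a measurable set, which is thus a
subset of nearly full measure. *)
Lemma analytic_inner E (a : R) : suslin measurable E -> a%:E < outer E ->
  exists K, [/\ measurable K, K `<=` E & a%:E <= mu K].
Proof.
move=> [A [lA mA ->]] aE.
pose agree m (s' s : nat -> nat) := forall i, (i < m)%N -> s' i = s i.
pose det n m s := forall s', agree m s' s -> A n s' = A n s.
(* [B m s] uses only those conditions that the first [m] coordinates settle *)
pose B m s := \bigcap_(n in [set n | (n <= m)%N /\ det n m s]) A n s.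
have mB m s : measurable (B m s).
  by apply: bigcap_measurableType => n _; exact: mA.
have detE n m s s' : agree m s' s -> det n m s -> det n m s'.
  move=> ss' dn u us'; rewrite (dn _ ss'); apply: dn => i im.
  by rewrite us'// ss'.
have agreeC m s s' : agree m s' s -> agree m s s' by move=> ss' i im; rewrite ss'.
have BE m s s' : agree m s' s -> B m s' = B m s.
  move=> ss'; apply/seteqP; split=> y By n /= [nm dn].
    by rewrite -(dn _ ss'); apply: By; split=> //; exact: detE ss' dn.
  by rewrite -(dn _ (agreeC _ _ _ ss')); apply: By; split=> //; exact: detE (agreeC _ _ _ ss') dn.
have niB s m m' : (m <= m')%N -> B m' s `<=` B m s.
  move=> mm' y By n /= [nm dn]; apply: By; split; first exact: leq_trans nm _.
  by move=> s' ss'; apply: dn => i im; apply: ss'; exact: leq_trans im _.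
have AB s y : (forall n, A n s y) <-> (forall m, B m s y).
  split=> [Ay m n _|By n]; first exact: Ay.
  have [m dm] := lA n s; apply: (By (maxn m n)); split; first exact: leq_maxr.
  by move=> s' ss'; apply: dm => i im; apply: ss'; rewrite leq_max im.
pose El l := [set y | exists2 s, (forall i, (i < size l)%N -> (s i <= nth 0%N l i)%N) &
  forall n, A n s y].
have [k kP] : exists k, forall n, a%:E < outer (El (mkseq k n)).
  apply: (@prefix_choice (fun l => a%:E < outer (El l))).
    suff -> : El [::] = [set y | exists s, forall n, A n s y] by [].
    by apply/seteqP; split=> y [s]; exists s.
  move=> l al; apply: contrapT => nl; move: al; apply/negP; rewrite -leNgt.
  have -> : El l = \bigcup_c El (rcons l c).
    apply/seteqP; split=> y.
      move=> [s sl As]; exists (s (size l)) => //; exists s => // i.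
      rewrite size_rcons ltnS leq_eqVlt nth_rcons => /predU1P[->|il].
        by rewrite ltnn eqxx.
      by rewrite il sl.
    move=> [c _ [s sl As]]; exists s => // i il; have := sl i.
    by rewrite size_rcons ltnS nth_rcons il; apply; exact: ltnW.
  apply: outer_bigcup_nd => [c c' cc' y [s sl As]|c].
    exists s => // i il; apply: (leq_trans (sl i _)).
      by move: il; rewrite !size_rcons.
    by rewrite !nth_rcons; case: ifP => //; case: ifP.
  by rewrite leNgt; apply/negP => alc; apply: nl; exists c.
pose bounded s := forall i, (s i <= k i)%N.
pose K m := [set y | exists2 s, bounded s & B m s y].
have mK m : measurable (K m).
  have -> : K m = \bigcup_(l in [set l : seq nat | bounded (nth 0%N l)]) B m (nth 0%N l).
    apply/seteqP; split=> y [s bs Bs].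
      exists (mkseq s m).
        move=> i /=; have [im|mi] := ltnP i m; first by rewrite nth_mkseq.
        by rewrite nth_default// size_mkseq.
      by rewrite (BE _ s)// => i im; rewrite nth_mkseq.
    by exists (nth 0%N s).
  rewrite bigcup_mkcond; apply: countable_bigcupT_measurable => // l.
  by case: ifP => // _; exact: mB.
have niK m m' : (m <= m')%N -> K m' `<=` K m.
  by move=> mm' y [s bs Bs]; exists s => //; exact: niB Bs.
have aK m : a%:E <= mu (K m).
  apply: ltW; apply: (lt_le_trans (kP m)); apply: outer_le_measure => // y [s sk As].
  exists (fun i => if (i < m)%N then s i else 0%N).
    move=> i; case: ifP => // im; have := sk i; rewrite size_mkseq nth_mkseq//.
    exact.
  have /AB := As => /(_ m); rewrite (BE m s)// => i im.
  by rewrite im.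
exists (\bigcap_m K m); split; [exact: bigcapT_measurable| |exact: ge_mu_bigcap_ni].
move=> y Ky.
pose good l := forall m, exists s, [/\ bounded s,
  forall i, (i < size l)%N -> s i = nth 0%N l i & B m s y].
have [s sP] : exists s, forall n, good (mkseq s n).
  apply: prefix_choice => [m|l gl]; first by have [s bs Bs] := Ky m I; exists s.
  apply: contrapT => ngl.
  have /choice[mc mcP] c : exists m, ~ exists s, [/\ bounded s,
      forall i, (i < size (rcons l c))%N -> s i = nth 0%N (rcons l c) i & B m s y].
    by apply/existsNP => glc; apply: ngl; exists c.
  have [s [bs sl Bs]] := gl (\max_(c < (k (size l)).+1) mc c)%N.
  apply: (mcP (s (size l))); exists s; split=> // [i|].
    rewrite size_rcons ltnS leq_eqVlt nth_rcons => /predU1P[->|il].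
      by rewrite ltnn eqxx.
    by rewrite il sl.
  apply: niB Bs; have lt_s : (s (size l) < (k (size l)).+1)%N by rewrite ltnS.
  exact: (@leq_bigmax _ (fun c : 'I_(k (size l)).+1 => mc c) (Ordinal lt_s)).
exists s; apply/AB => m; have [s' [_ s's Bs']] := sP m m.
rewrite -(BE m s s')// => i im; rewrite s's ?size_mkseq// nth_mkseq//.
Qed.

(** Measurability for the completion of [mu], without forming the completion. *)
Definition completion_measurable E : Prop := exists B0 B1,
  [/\ measurable B0, measurable B1, B0 `<=` E, E `<=` B1 & mu (B1 `\` B0) = 0].

(** Lusin's theorem: measurable subsets exhaust the outer measure of [E], and a
hull of [E] has that same measure. *)
Lemma analytic_completion E : suslin measurable E -> completion_measurable E.
Proof.
move=> sE; have [B1 [mB1 EB1 muB1]] := outer_hull E.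
have /choice[K KP] (n : nat) : exists K, [/\ measurable K, K `<=` E &
    outer E - (n.+1%:R^-1)%:E <= mu K].
  have /fineK <- := outer_fin_num E; rewrite -EFinB; apply: analytic_inner => //.
  by rewrite -[ltRHS](fineK (outer_fin_num E)) lte_fin ltrBlDr ltrDl invr_gt0.
have mK : measurable (\bigcup_n K n).
  by apply: bigcupT_measurable => n; have [] := KP n.
have KE : \bigcup_n K n `<=` E by move=> x [n _ Kx]; have [_ + _] := KP n; exact.
exists (\bigcup_n K n), B1; split=> //.
rewrite measureD ?(setIidr (subset_trans KE EB1))//; last first.
  by rewrite ltey_eq fin_num_measure.
apply/eqP; rewrite eq_le; apply/andP; split; last first.
  rewrite sube_ge0 ?fin_num_measure//.
  by apply: le_measure; rewrite ?inE//; exact: subset_trans EB1.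
rewrite sube_le0 [leLHS]muB1; apply/lee_addgt0Pr => e e0.
have [n ne] := exists_invS_lt e0.
have [mKn _ Kn] := KP n; rewrite -leeBlDr//.
apply: le_trans (le_trans Kn _).
  by rewrite leeB// lee_fin ltW.
by apply: le_measure; rewrite ?inE//; exact: bigcup_sup.
Qed.

Lemma measurable_completion E : measurable E -> completion_measurable E.
Proof. by move=> mE; exists E, E; split=> //; rewrite setDv measure0. Qed.

Lemma completion_measurableC E : completion_measurable E ->
  completion_measurable (~` E).
Proof.
move=> [B0 [B1 [m0 m1 B0E EB1 B01]]]; exists (~` B1), (~` B0); split.
- exact: measurableC.
- exact: measurableC.
- exact: subsetC.
- exact: subsetC.
- by rewrite -B01; congr (mu _); rewrite setDE setCK setIC -setDE.
Qed.

Lemma completion_measurable_bigcup (E : (set T)^nat) :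
  (forall n, completion_measurable (E n)) -> completion_measurable (\bigcup_n E n).
Proof.
move=> /choice[B0 /choice[B1 BP]]; exists (\bigcup_n B0 n), (\bigcup_n B1 n).
have mB0 : measurable (\bigcup_n B0 n).
  by apply: bigcupT_measurable => n; have [] := BP n.
have mB1 : measurable (\bigcup_n B1 n).
  by apply: bigcupT_measurable => n; have [] := BP n.
split=> //.
- by move=> x [n _ Bx]; exists n => //; have [_ _ + _ _] := BP n; exact.
- by move=> x [n _ Ex]; exists n => //; have [_ _ _ + _] := BP n; exact.
apply: (@measure_negligible _ _ _ mu); first exact: measurableD.
apply: (@negligibleS _ _ _ _ (\bigcup_n (B1 n `\` B0 n))).
  by move=> x [[n _ B1x] nB0]; exists n => //; split=> // B0x; apply: nB0; exists n.
apply: negligible_bigcup => n; have [m0 m1 _ _ B01] := BP n.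
by apply/negligibleP => //; exact: measurableD.
Qed.

Lemma completion_measurableU E F : completion_measurable E ->
  completion_measurable F -> completion_measurable (E `|` F).
Proof.
move=> mE mF; rewrite -bigcup2E; apply: completion_measurable_bigcup => -[|[|k]] //=.
exact: measurable_completion.
Qed.

Lemma completion_measurableI E F : completion_measurable E ->
  completion_measurable F -> completion_measurable (E `&` F).
Proof.
move=> mE mF; rewrite -[E `&` F]setCK setCI.
by apply/completion_measurableC/completion_measurableU; exact: completion_measurableC.
Qed.

Lemma completion_measurable_bigcap (E : (set T)^nat) :
  (forall n, completion_measurable (E n)) ->
  completion_measurable (\bigcap_n E n).
Proof.
move=> mE; rewrite -[\bigcap_n E n]setCK setC_bigcap.
apply/completion_measurableC/completion_measurable_bigcup => n.
exact: completion_measurableC.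
Qed.

End OuterMeasure.

(** * Borel sets of Polish spaces *)

(** A point off [D] is the centre of a ball that misses [D].  The points with such
a ball of a given radius may be replaced by their closure, which misses [D] too. *)
Lemma closedC_Fsigma (R : realType) (M : metricType R) (D : set M) : closed D ->
  exists2 F : nat -> set M, forall n, closed (F n) & ~` D = \bigcup_n F n.
Proof.
move=> cD; pose G (n : nat) := [set x : M | ball x (n.+1%:R^-1 : R) `<=` ~` D].
exists (fun n => closure (G n)) => [n|]; first exact: closed_closure.
apply/seteqP; split=> x.
  move=> nDx; have : nbhs x (~` D) by apply: open_nbhs_nbhs; split=> //; exact: closed_openC.
  move=> /nbhs_ballP[e /= /exists_invS_lt[n ne] xeD].
  exists n => //; apply: subset_closure => y xy; apply: xeD.
  by apply: le_ball xy; exact: ltW.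
move=> [n _ Gx] Dx.
have n0 : (0 : R) < n.+1%:R^-1 by rewrite invr_gt0.
have [y [Gy xy]] := Gx _ (nbhsx_ballx x _ n0).
by apply: Gy Dx; exact: ball_sym.
Qed.

Section PolishBorel.
Context (R : realType) d (T : measurableType d).
Hypothesis polT : polish_borel R T.

Lemma polish_borel_scheme : exists cl Bl,
  polish_scheme cl Bl /\ @measurable d T = <<s cl>>.
Proof.
have [M [f [[g fK gK] [cM [S [cS dS]]] mT]]] := polT.
pose cl : set (set T) := [set C | exists2 D, closed D & C = f @^-1` D].
have [e eS] : exists e : nat -> M, forall x, S x -> exists n, e n = x.
  have /countable_injP[i injS] := cS.
  have /choice[e eP] n : exists y, (exists2 x, S x & i x = n) -> S y /\ i y = n.
    have [[x Sx ix]|no] := pselect (exists2 x, S x & i x = n); first by exists x.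
    by exists (f point).
  exists e => x Sx; exists (i x); have [|Sy iy] := eP (i x); first by exists x.
  by apply: injS => //; rewrite inE.
pose Bl (n k : nat) : set T := f @^-1` ball (e k) (n.+1%:R^-1 : R).
exists cl, Bl; split; first split.
- by exists setT; [exact: closedT|rewrite preimage_setT].
- move=> _ [D /closedC_Fsigma[F cF FD] ->]; exists (fun n => f @^-1` F n).
    by move=> n; exists (F n).
  by rewrite -preimage_bigcup -FD.
- move=> n t; have n0 : (0 : R) < n.+1%:R^-1 by rewrite invr_gt0.
  have [|x [xft Sx]] := dS (ball (f t) (n.+1%:R^-1 : R))^° _ (open_interior _).
    by exists (f t); exact: nbhsx_ballx.
  have [k ek] := eS x Sx; exists k; rewrite /Bl /= ek.
  by apply: ball_sym; exact: interior_subset xft.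
- move=> C tau clC /choice[t tP].
  pose F := (f \o t) @ \oo.
  have Fball m : F (ball (e (tau m)) (m.+1%:R^-1 : R)).
    by exists m => // n /= mn; have [] := tP n m mn.
  have cF : cauchy F.
    apply: cauchy_exP => r /exists_invS_lt[m mr]; exists (e (tau m)).
    by apply: filterS (Fball m); apply: le_ball; exact: ltW.
  have [x Fx] := cM F _ cF.
  exists (g x) => m; have [D cD eC] := clC m; rewrite eC /= gK.
  apply: (@closed_cvg _ _ \oo _ (f \o t) D cD _ x Fx).
  by exists m => // n /= mn; have [] := tP n m mn; rewrite eC.
apply/seteqP; split=> A.
  move=> /mT[B sB ->]; move: B sB.
  suff : <<s (@open M) >> `<=` [set B | <<s cl >> (f @^-1` B)] by [].
  apply: smallest_sub.
    split=> [|B sB|F sF]; rewrite /= ?preimage_set0.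
    - exact: (@measurable0 _ (g_sigma_algebraType cl)).
    - rewrite setTD -preimage_setC.
      exact: (@measurableC _ (g_sigma_algebraType cl)).
    - by rewrite preimage_bigcup; exact: (@bigcupT_measurable _ (g_sigma_algebraType cl)).
  move=> U oU /=; rewrite -[U]setCK -preimage_setC.
  apply: (@measurableC _ (g_sigma_algebraType cl)); apply: sub_sigma_algebra.
  by exists (~` U) => //; exact: open_closedC.
move: A; apply: smallest_sub; first exact: sigma_algebra_measurable.
move=> _ [D cD ->]; apply/mT; exists D => //.
rewrite -[D]setCK -[X in <<s _ >> X]setTD.
apply: sigma_algebraCD; apply: sub_sigma_algebra; exact: closed_openC.
Qed.

Lemma polish_borel_set1 (x : T) : measurable [set x].
Proof.
have [M [f [[g fK gK] _ mT]]] := polT; apply/mT; exists [set f x].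
  rewrite -[[set f x]]setCK -[X in <<s _ >> X]setTD.
  apply: sigma_algebraCD; apply: sub_sigma_algebra; apply: closed_openC.
  exact/accessible_closed_set1/hausdorff_accessible/metric_hausdorff.
apply/seteqP; split=> y /= [e]; rewrite ?e//.
by apply: (can_inj fK).
Qed.

End PolishBorel.

(** * Measurability of the SOA in the sample *)

Lemma measurable_eq_bool d (Y : measurableType d) (a b : Y -> bool) :
  measurable_fun setT a -> measurable_fun setT b ->
  measurable [set y | a y == b y].
Proof.
move=> ma mb; have mpre (c : Y -> bool) v : measurable_fun setT c ->
    measurable (c @^-1` [set v]).
  by move=> mc; rewrite -[X in measurable X]setTI; exact: mc.
suff -> : [set y | a y == b y] = (a @^-1` [set true] `&` b @^-1` [set true]) `|`
    (a @^-1` [set false] `&` b @^-1` [set false]).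
  by apply: measurableU; apply: measurableI; exact: mpre.
apply/seteqP; split=> y /=; last by move=> -[] [-> ->].
by case: (a y); case: (b y) => // _; [left|right].
Qed.

Lemma measurable_consistent d (Y : measurableType d) d' (X : measurableType d')
    (h : Y -> X -> bool) (F : nat -> Y -> X * bool) n :
  measurable_fun setT (fun p : Y * X => h p.1 p.2) ->
  (forall i, measurable_fun setT (F i)) ->
  measurable [set y | consistent (h y) (mkseq (F^~ y) n)].
Proof.
move=> mh mF; elim: n => [|n IH].
  by rewrite (_ : [set _ | _] = setT)//; apply/seteqP; split.
rewrite (_ : [set _ | _] = [set y | consistent (h y) (mkseq (F^~ y) n)] `&`
    [set y | h y (F n y).1 == (F n y).2]).
  apply: measurableI => //; apply: measurable_eq_bool.
    apply: (measurableT_comp (f := fun p : Y * X => h p.1 p.2)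
              (g := fun y => (y, (F n y).1))) => //.
    by apply: measurable_fun_pair => //; exact: measurableT_comp.
  exact: measurableT_comp.
by apply/seteqP; split=> y; rewrite /setI /mkset mkseqS consistent_rcons => /andP.
Qed.

(** The leaves of a shattered tree ask for a parameter and its nodes for a point
of the domain, one existential quantifier at a time; a finite tree needs finitely
many of them, so shattering is a projection of a measurable condition. *)
Lemma analytic_shatters_param d (X : measurableType d) d' (Th : measurableType d')
    clX BlX clT BlT (h : Th * X -> bool) :
  polish_scheme clX BlX -> @measurable d X = <<s clX>> ->
  polish_scheme clT BlT -> @measurable d' Th = <<s clT>> ->
  measurable_fun setT h ->
  let H := range (fun th => fun x => h (th, x)) in
  forall t dY (Y : measurableType dY) (F : nat -> Y -> X * bool) n,
  (forall i, measurable_fun setT (F i)) ->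
  suslin measurable
    [set y | shatters_depth (version_space H (mkseq (F^~ y) n)) t].
Proof.
move=> sX mX sT mT mh H; elim=> [|t IH] dY Y F n mF.
  rewrite (_ : [set _ | _] = [set y | exists th,
      [set p : Y * Th | consistent (fun x => h (p.2, x))
         (mkseq (fun i => F i p.1) n)] (y, th)]).
    apply: (analytic_projection sT mT); apply: sub_suslin.
    apply: (measurable_consistent (h := fun p x => h (p.2, x))
              (F := fun i p => F i p.1)).
      apply: (measurableT_comp (f := h)) => //.
      by apply: measurable_fun_pair => //; exact: measurableT_comp.
    by move=> i; exact: measurableT_comp.
  apply/seteqP; split=> y /=.
    by move=> /shatters_depth0[_ [[th _ <-] /= hth]]; exists th.
  by move=> [th hth]; apply/shatters_depth0; exists (fun x => h (th, x)); split=> //; exists th.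
pose G b i (p : Y * X) := if i == n then (p.2, b) else F i p.1.
have mG b i : measurable_fun setT (G b i).
  rewrite /G; case: eqP => _; last exact: measurableT_comp.
  exact: measurable_fun_pair.
have GE b y x : mkseq ((G b)^~ (y, x)) n.+1 = rcons (mkseq (F^~ y) n) (x, b).
  rewrite mkseqS {2}/G eqxx; congr (rcons _ _).
  apply/eq_in_map => i; rewrite mem_iota /= add0n /G => lt_in.
  by rewrite ltn_eqF.
pose E b := [set p | shatters_depth (version_space H (mkseq ((G b)^~ p) n.+1)) t].
rewrite (_ : [set _ | _] = [set y | exists x, (E true `&` E false) (y, x)]).
  by apply: (analytic_projection sX mX); apply: analyticI; exact: IH.
apply/seteqP; split=> y /=; rewrite shatters_depth_rconsS.
  by move=> [x sh]; exists x; rewrite /E /= !GE.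
by move=> [x]; rewrite /E /= !GE => -[sh1 sh0]; exists x => -[].
Qed.

(** Over a countable domain the class is arbitrary, but a finite word of draws has
countably many values, so any condition on it is measurable. *)
Lemma measurable_countable_seq d (X : measurableType d) dY (Y : measurableType dY)
    (F : nat -> Y -> X) n (Q : set (seq X)) :
  countable [set: X] -> (forall x : X, measurable [set x]) ->
  (forall i, measurable_fun setT (F i)) ->
  measurable [set y | Q (mkseq (F^~ y) n)].
Proof.
move=> cX mX mF; elim: n Q => [|n IH] Q.
  have [Q0|nQ0] := pselect (Q [::]).
    by rewrite (_ : [set _ | _] = setT)//; apply/seteqP; split.
  by rewrite (_ : [set _ | _] = set0)//; apply/seteqP; split.
rewrite (_ : [set _ | _] = \bigcup_x
  (F n @^-1` [set x] `&` [set y | Q (rcons (mkseq (F^~ y) n) x)])).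
  apply: countable_bigcupT_measurable => // x; apply: measurableI.
    by rewrite -[X in measurable X]setTI; exact: mF.
  exact: (IH (fun s => Q (rcons s x))).
apply/seteqP; split=> y; rewrite /bigcup /setI /mkset mkseqS.
  by move=> Qy; exists (F n y).
by move=> [x _ [<-]].
Qed.

Section MeasurabilityAssumption.
Context (R : realType) d (X : measurableType d) (H : set (X -> bool)).
Hypothesis hH : measurability_assumption R H.

Lemma measurability_assumption_set1 (z : X * bool) : measurable [set z].
Proof.
have mx (x : X) : measurable [set x].
  by case: hH => [[_]|[pX _]]; [exact|exact: polish_borel_set1 pX x].
case: z => x b; rewrite (_ : [set (x, b)] = [set x] `*` [set b]).
  exact: measurableX.
by apply/seteqP; split=> -[x' b'] /= [-> ->].
Qed.

Lemma analytic_shatters t dY (Y : measurableType dY) (F : nat -> Y -> X * bool) n :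
  (forall i, measurable_fun setT (F i)) ->
  suslin measurable [set y | shatters_depth (version_space H (mkseq (F^~ y) n)) t].
Proof.
move=> mF; have := hH => -[[cX mX]|[pX [H0|[d' [Th [h [pT mh HE]]]]]]].
- apply: sub_suslin; apply: (@measurable_countable_seq _ _ _ _ F n (fun s =>
      shatters_depth (version_space H s) t)) => //.
    rewrite -setXTT; apply: countableX => //; exact: countableP.
  exact: measurability_assumption_set1.
- apply: sub_suslin; rewrite (_ : [set _ | _] = set0)//; apply/seteqP; split=> y //=.
  move=> /(leq_shatters_depth (leq0n t))/shatters_depth0[f []].
  by rewrite H0.
- have [clX [BlX [sX mX]]] := polish_borel_scheme pX.
  have [clT [BlT [sT mT]]] := polish_borel_scheme pT.
  by rewrite HE; exact: (analytic_shatters_param sX mX sT mT mh).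
Qed.

(** The SOA compares two dimensions, which is a countable Boolean combination of
analytic conditions: in general the error set is not analytic any more, but it
is measurable for the completion of every finite measure. *)
Lemma completion_measurable_SOA_error dY (Y : measurableType dY)
    (mu : {finite_measure set Y -> \bar R}) (F : nat -> Y -> X * bool) n
    (g : Y -> X * bool) :
  (forall i, measurable_fun setT (F i)) -> measurable_fun setT g ->
  completion_measurable mu
    [set y | SOA_hyp R H (mkseq (F^~ y) n) (g y).1 != (g y).2].
Proof.
move=> mF mg.
pose G b i (y : Y) := if i == n then ((g y).1, b) else F i y.
have mG b i : measurable_fun setT (G b i).
  rewrite /G; case: eqP => // _; apply: measurable_fun_pair => //.
  exact: measurableT_comp.
have GE b y : mkseq ((G b)^~ y) n.+1 = rcons (mkseq (F^~ y) n) ((g y).1, b).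
  rewrite mkseqS {2}/G eqxx; congr (rcons _ _).
  apply/eq_in_map => i; rewrite mem_iota /= add0n /G => lt_in.
  by rewrite ltn_eqF.
pose E b t := [set y | shatters_depth (version_space H (mkseq ((G b)^~ y) n.+1)) t].
have mE b t : completion_measurable mu (E b t).
  by apply: analytic_completion; exact: analytic_shatters.
pose S := \bigcap_t (~` E false t `|` E true t).
have mS : completion_measurable mu S.
  apply: completion_measurable_bigcap => t.
  by apply: completion_measurableU => //; exact: completion_measurableC.
have SE y : SOA_hyp R H (mkseq (F^~ y) n) (g y).1 <-> S y.
  rewrite /SOA_hyp le_LdimP; split=> [le t _|Sy t].
    have [Ef|] := pselect (E false t y); last by left.
    by right; move: Ef; rewrite /E /= !GE; exact: le.
  by have [] := Sy t I; rewrite /E /= !GE.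
have mgb b : completion_measurable mu [set y | (g y).2 = b].
  apply: measurable_completion; rewrite -[X in measurable X]setTI.
  have m2 : measurable_fun setT (fun y => (g y).2) by exact: measurableT_comp.
  exact: (m2 measurableT [set b]).
rewrite (_ : [set _ | _] = (S `&` [set y | (g y).2 = false]) `|`
    (~` S `&` [set y | (g y).2 = true])).
  by apply: completion_measurableU; apply: completion_measurableI => //;
     exact: completion_measurableC.
apply/seteqP; split=> y /=.
  case e : SOA_hyp; case: (g y).2 => //= _.
    by left; split=> //; apply/SE; rewrite e.
  by right; split=> // /SE; rewrite e.
move=> [[/SE -> ->//]|[nS ->]].
by rewrite eqb_id; apply/negP => /SE.
Qed.

End MeasurabilityAssumption.

(** * Independent sigma-algebras and product measures *)

Section Probability.
Local Open Scope ereal_scope.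

Definition law d d' (Om : measurableType d) (T : measurableType d') (R : realType)
    (P : probability Om R) (f : Om -> T) (mf : measurable_fun setT f) :
    probability T R := distribution P (mfun_Sub (mem_set mf)).

Lemma law_ae d d' (Om : measurableType d) (T : measurableType d') (R : realType)
    (P : probability Om R) (f : Om -> T) (mf : measurable_fun setT f) (Q : T -> Prop) :
  {ae law P mf, forall x, Q x} -> {ae P, forall w, Q (f w)}.
Proof.
move=> [A [mA PA QA]]; exists (f @^-1` A); split=> //.
  by rewrite -[X in measurable X]setTI; exact: (mf).
by move=> w nQ; exact: QA.
Qed.

Section Independence.
Context d (Om : measurableType d) (R : realType) (P : probability Om R).
Implicit Types (G : set (set Om)) (A B : set Om).

Lemma indep_sigma_l G B : G `<=` measurable -> setI_closed G -> G setT ->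
  measurable B -> (forall A, G A -> P (A `&` B) = P A * P B) ->
  forall A, <<s G>> A -> P (A `&` B) = P A * P B.
Proof.
move=> mG GI GT mB GB A sA.
have PBfin : P B \is a fin_num by exact: fin_num_measure.
have PB0 : (0 <= fine (P B))%R by exact: fine_ge0.
have cov : \bigcup_(_ : nat) setT = [set: Om] by rewrite bigcup_const//; exists 0%N.
pose m2 := mscale (NngNum PB0) P.
have m2E A' : m2 A' = P A' * P B by rewrite /m2 /mscale /= fineK// muleC.
rewrite -m2E.
apply: (@g_sigma_algebra_measure_unique _ R Om G mG (fun=> setT) (fun=> GT) cov
  (mrestr P mB) m2 GI) => // [A' GA'|_].
  by apply: etrans (esym (m2E A')); exact: GB.
by change (P (setT `&` B) < +oo); rewrite setTI ltey_eq PBfin.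
Qed.

Lemma indep_sigma G1 G2 : G1 `<=` measurable -> setI_closed G1 -> G1 setT ->
  G2 `<=` measurable -> setI_closed G2 -> G2 setT ->
  (forall A B, G1 A -> G2 B -> P (A `&` B) = P A * P B) ->
  forall A B, <<s G1>> A -> <<s G2>> B -> P (A `&` B) = P A * P B.
Proof.
move=> m1 I1 T1 m2 I2 T2 ind A B sA sB.
have mB : measurable B.
  by move: B sB; apply: smallest_sub => //; exact: sigma_algebra_measurable.
apply: (indep_sigma_l m1) => // A' GA'.
rewrite setIC muleC; apply: (indep_sigma_l m2) => //; first exact: m1.
by move=> B' GB'; rewrite setIC muleC; exact: ind.
Qed.

(** Independence of two sub-sigma-algebras in terms of the diagonal map: the
event that involves both is computed on the product space, where Fubini
applies. *)
Lemma indep_diagonal G1 G2 (m1 : measurable_fun setT (id : Om -> g_sigma_algebraType G1))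
    (m2 : measurable_fun setT (id : Om -> g_sigma_algebraType G2)) :
  (forall A B, <<s G1>> A -> <<s G2>> B -> P (A `&` B) = P A * P B) ->
  forall E : set (g_sigma_algebraType G1 * g_sigma_algebraType G2), measurable E ->
  P [set w | E (w, w)] = (law P m1 \x law P m2) E.
Proof.
move=> ind E mE; have mdiag := measurable_fun_pair m1 m2.
by rewrite (@product_measure_unique _ _ _ _ _ (law P m1) (law P m2) (law P mdiag)).
Qed.

End Independence.

Lemma product_null_section d1 d2 (T1 : measurableType d1) (T2 : measurableType d2)
    (R : realType) (m1 : probability T1 R) (m2 : probability T2 R) (E : set (T1 * T2)) :
  measurable E -> (m1 \x m2) E = 0 -> {ae m1, forall x, m2 (xsection E x) = 0}.
Proof.
move=> mE E0; have mf := measurable_fun_xsection m2 mE.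
have /(ae_eq_integral_abs _ measurableT mf) ae0 :
    \int[m1]_x `|(m2 \o xsection E) x| = 0.
  by rewrite -[RHS]E0; apply: eq_integral => x _; rewrite gee0_abs.
by apply: filterS ae0 => x /(_ I).
Qed.

End Probability.

(** * The SOA is eventually correct *)

Section IID.
Local Open Scope ereal_scope.
Context (R : realType) d d' (T : measurableType d) (D : probability T R)
  (Om : measurableType d') (P : probability Om R) (Z : nat -> {RV P >-> T}).
Hypothesis iidZ : iid D Z.

(** Events that depend on finitely many of the draws with index in [J]; they
generate the sigma-algebra of those draws, as a pi-system on [Om] itself. *)
Definition cylinders (J : pred nat) : set (set Om) :=
  [set C | exists k B, (forall i, measurable (B i)) /\
     C = \bigcap_(i in [set` [seq i <- iota 0 k | J i]]) Z i @^-1` B i].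

Lemma measurable_preimage_RV i B : measurable B -> measurable (Z i @^-1` B).
Proof. by move=> mB; rewrite -[X in measurable X]setTI; exact: measurable_funP. Qed.

Lemma cylinders_measurable J : cylinders J `<=` measurable.
Proof.
move=> _ [k [B [mB ->]]]; apply: bigcap_measurableType => i _.
exact: measurable_preimage_RV.
Qed.

Lemma cylindersT J : cylinders J setT.
Proof.
exists 0%N, (fun=> setT); split=> //.
by apply/seteqP; split.
Qed.

Lemma cylinders_setI J : setI_closed (cylinders J).
Proof.
move=> _ _ [k1 [B1 [mB1 ->]]] [k2 [B2 [mB2 ->]]].
exists (maxn k1 k2), (fun i => (if (i < k1)%N then B1 i else setT) `&`
                              (if (i < k2)%N then B2 i else setT)); split.
  by move=> i; apply: measurableI; case: ifP.
apply/seteqP; split=> w.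
  move=> [w1 w2] i; rewrite /= mem_filter mem_iota leq0n add0n => /andP[Ji _].
  split; case: ifP => // lt_ik.
    by apply: w1; rewrite /= mem_filter mem_iota Ji.
  by apply: w2; rewrite /= mem_filter mem_iota Ji.
move=> w12; split=> i; rewrite /= mem_filter mem_iota add0n => /andP[Ji /andP[_ lt_ik]].
  have [|+ _] := w12 i; last by rewrite lt_ik.
  by rewrite /= mem_filter mem_iota Ji /= add0n leq_max lt_ik.
have [|_] := w12 i; last by rewrite lt_ik.
by rewrite /= mem_filter mem_iota Ji /= add0n leq_max lt_ik orbT.
Qed.

Lemma cylinders_RV (J : pred nat) i B : J i -> measurable B ->
  cylinders J (Z i @^-1` B).
Proof.
move=> Ji mB; exists i.+1, (fun j => if j == i then B else setT); split.
  by move=> j; case: ifP.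
apply/seteqP; split=> w.
  by move=> Bw j _ /=; case: eqP => // ->.
have im : [set` [seq j <- iota 0 i.+1 | J j]] i.
  by rewrite /mkset mem_filter mem_iota Ji add0n ltnSn.
by move=> /(_ i im); rewrite /= eqxx.
Qed.

Lemma cylinders_indep (J1 J2 : pred nat) A B : (forall i, J1 i -> ~~ J2 i) ->
  cylinders J1 A -> cylinders J2 B -> P (A `&` B) = P A * P B.
Proof.
move=> J12 [k1 [B1 [mB1 ->]]] [k2 [B2 [mB2 ->]]]; have [_ prodZ] := iidZ.
set s1 := [seq _ <- iota 0 k1 | _]; set s2 := [seq _ <- iota 0 k2 | _].
pose B3 i := if J1 i then B1 i else B2 i.
have mB3 i : measurable (B3 i) by rewrite /B3; case: ifP.
have u1 : uniq s1 by rewrite filter_uniq ?iota_uniq.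
have u2 : uniq s2 by rewrite filter_uniq ?iota_uniq.
have u12 : uniq (s1 ++ s2).
  rewrite cat_uniq u1 u2 andbT; apply/hasPn => i; rewrite !mem_filter => /andP[J2i _].
  by apply/negP => /andP[/J12]; rewrite J2i.
have E1 : \bigcap_(i in [set` s1]) Z i @^-1` B1 i = \bigcap_(i in [set` s1]) Z i @^-1` B3 i.
  by apply: eq_bigcapr => i; rewrite /= mem_filter /B3 => /andP[->].
have E2 : \bigcap_(i in [set` s2]) Z i @^-1` B2 i = \bigcap_(i in [set` s2]) Z i @^-1` B3 i.
  apply: eq_bigcapr => i; rewrite /= mem_filter /B3 => /andP[J2i _].
  by case: ifP => // /J12; rewrite J2i.
rewrite E1 E2 -bigcap_setU (_ : _ `|` _ = [set` s1 ++ s2]).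
  by rewrite !prodZ// big_cat.
apply/seteqP; split=> i /=; rewrite mem_cat; first by case=> ->; rewrite ?orbT.
by move=> /orP[]; [left|right].
Qed.

Lemma measurable_id_cylinders J :
  measurable_fun setT (id : Om -> g_sigma_algebraType (cylinders J)).
Proof.
move=> _ A mA; rewrite setTI preimage_id.
by move: A mA; apply: smallest_sub (@cylinders_measurable J); exact: sigma_algebra_measurable.
Qed.

Lemma measurable_RV_cylinders (J : pred nat) i : J i ->
  measurable_fun setT (Z i : g_sigma_algebraType (cylinders J) -> T).
Proof.
move=> Ji _ B mB; rewrite setTI; apply: sub_sigma_algebra.
exact: cylinders_RV.
Qed.

(** By independence, the probability is at most every power of [D (~` C) < 1]. *)
Lemma iid_avoid C N : measurable C -> 0 < D C ->
  P (\bigcap_(i in [set i | (N <= i)%N]) Z i @^-1` (~` C)) = 0.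
Proof.
move=> mC C0; have [lawZ prodZ] := iidZ.
have mA : measurable (\bigcap_(i in [set i | (N <= i)%N]) Z i @^-1` (~` C)).
  apply: bigcap_measurableType => i _.
  by apply: measurable_preimage_RV; exact: measurableC.
set p := fine (D (~` C)).
have DC : D (~` C) = p%:E by rewrite fineK// fin_num_measure//; exact: measurableC.
have p0 : (0 <= p)%R by rewrite -lee_fin -DC.
have p1 : (p < 1)%R.
  rewrite -lte_fin -DC probability_setC// lteBlDr ?fin_num_measure//.
  by rewrite lteDl.
have le_pm m : P (\bigcap_(i in [set i | (N <= i)%N]) Z i @^-1` (~` C)) <= (p ^+ m)%:E.
  apply: (@le_trans _ _ (P (\bigcap_(i in [set` iota N m]) Z i @^-1` (~` C)))).
    apply: le_measure; rewrite ?inE//.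
      apply: bigcap_measurableType => i _.
      by apply: measurable_preimage_RV; exact: measurableC.
    by move=> w Cw i /=; rewrite mem_iota => /andP[Ni _]; exact: Cw.
  rewrite (prodZ _ (fun=> ~` C)) ?iota_uniq//; last by move=> _; exact: measurableC.
  rewrite (eq_bigr (fun=> p%:E)) => [|i _]; last first.
    by rewrite -DC -(lawZ i)//; exact: measurableC.
  rewrite prodEFin lee_fin big_const_seq count_predT size_iota.
  by rewrite iter_mulr_1.
apply/eqP; rewrite eq_le measure_ge0 andbT.
have pcvg : (p ^+ m)%:E @[m --> \oo] --> 0%:E.
  by apply: cvg_EFin; [exact: nearW|apply: cvg_expr; rewrite ger0_norm].
rewrite -[leRHS](cvg_lim _ pcvg)//; apply: lime_ge; first by apply/cvg_ex; eexists; exact: pcvg.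
exact: nearW.
Qed.

End IID.

Section SOA_PEC.
Local Open Scope ereal_scope.
Context (R : realType) d (X : measurableType d) (H : set (X -> bool)).
Context (D : probability (X * bool)%type R).
Context d' (Om : measurableType d') (P : probability Om R)
  (Z : nat -> {RV P >-> (X * bool)%type}).
Hypothesis iidZ : iid D Z.

(** Each finite prefix is consistent with hypotheses of arbitrarily small loss,
except on events of arbitrarily small probability. *)
Lemma realizable_ae : realizable H D ->
  {ae P, forall w, realizable_seq H (fun i => Z i w)}.
Proof.
move=> realD; apply: ae_foralln => n.
suff : P.-negligible [set w | ~ exists2 h, H h & consistent h (mkseq (fun i => Z i w) n)].
  by [].
set N := [set w | _].
have outer0 : (P^*)%mu N <= 0.
  apply/lee_addgt0Pr => e e0; rewrite add0e.
  pose r := (e / (n.+1%:R) / 2)%R.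
  have r0 : (0 < r)%R by rewrite /r !divr_gt0.
  have fin : ereal_inf [set loss D h | h in H] \is a fin_num by rewrite realD.
  have [_ [h Hh <-]] := lb_ereal_inf_adherent r0 fin.
  rewrite realD add0e => lossh.
  have [B [mB errB DB]] := outer_cover D [set z | h z.1 != z.2] r0.
  apply: (@le_trans _ _ (P (\big[setU/set0]_(i < n) (Z i @^-1` B)))).
    apply: outer_le_measure.
      by apply: bigsetU_measurable => i _; exact: measurable_preimage_RV.
    move=> w Nw; rewrite -(bigcup_mkord n (fun i => Z i @^-1` B)); apply: contrapT => nB; apply: Nw.
    exists h => //; apply/allP => z /mapP[i]; rewrite mem_iota /= add0n => lt_in ->.
    by apply/negPn/negP => /errB Bz; apply: nB; exists i.
  apply: (le_trans (Boole_inequality (A := fun i => Z i @^-1` B) _ _)).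
    by move=> i _; exact: measurable_preimage_RV.
  have [lawZ _] := iidZ.
  apply: (@le_trans _ _ (\sum_(i < n) (r + r)%:E)).
    apply: lee_sum => i _; rewrite [leLHS](lawZ i)// ltW//.
    by apply: lt_trans DB _; rewrite EFinD lteD2rE.
  rewrite sumEFin lee_fin sumr_const card_ord /r -splitr -[leLHS]mulr_natr -mulrA.
  by rewrite ger_pMr// ler_pdivrMl// mulr1 ler_nat.
have [B [mB NB PB]] := outer_hull P N.
exists B; split=> //; apply/eqP; rewrite eq_le measure_ge0 andbT.
by rewrite [leLHS]PB.
Qed.

Hypothesis hH : measurability_assumption R H.
Variables (N : nat) (js : seq nat).

(** The draws at the positions [js].  Positions from [N] on are replaced by a
constant, so that the outcome always depends on the first [N] draws only. *)
Definition chosen (j : nat) (w : Om) : X * bool :=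
  if (nth 0%N js j < N)%N then Z (nth 0%N js j) w else point.

Definition chosen_hyp (w : Om) : X -> bool :=
  SOA_hyp R H (mkseq (chosen^~ w) (size js)).

(** The heart of the matter.  The hypothesis is a function of the first [N] draws
and is tested on independent ones.  Its error set is measurable jointly in the
sample and the tested example, up to null sets, so Fubini allows the sample to be
held fixed: an error set of positive probability is then hit almost surely. *)
Lemma SOA_hyp_correct_ae : {ae P, forall w,
  (forall j, (N <= j)%N -> chosen_hyp w (Z j w).1 = (Z j w).2) ->
  loss D (chosen_hyp w) = 0}.
Proof.
pose before : pred nat := fun i => (i < N)%N.
pose after : pred nat := fun i => (N <= i)%N.
pose Om1 := g_sigma_algebraType (cylinders Z before).
pose Om2 := g_sigma_algebraType (cylinders Z after).
have mid1 : measurable_fun setT (id : Om -> Om1) by exact: measurable_id_cylinders.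
have mid2 : measurable_fun setT (id : Om -> Om2) by exact: measurable_id_cylinders.
have ind A B : <<s cylinders Z before>> A -> <<s cylinders Z after>> B ->
    P (A `&` B) = P A * P B.
  apply: indep_sigma => //; try exact: cylinders_measurable;
    try exact: cylinders_setI; try exact: cylindersT.
  move=> {}A {}B; apply: (cylinders_indep iidZ) => i.
  by rewrite /before /after -ltnNge.
have mchosen j : measurable_fun setT (chosen j : Om1 -> X * bool).
  rewrite /chosen; case: (ltnP (nth 0%N js j) N) => lt_jN; last exact: measurable_cst.
  exact: measurable_RV_cylinders.
pose M : set (Om1 * (X * bool)) := [set p | chosen_hyp p.1 p.2.1 != p.2.2].
have [M0 [M1 [mM0 mM1 M0M MM1 M10]]] :
    completion_measurable [the probability _ _ of law P mid1 \x D] M.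
  have := @completion_measurable_SOA_error _ _ _ _ hH _ _
    [the probability _ _ of law P mid1 \x D]
    (fun j (p : Om1 * (X * bool)) => chosen j p.1) (size js) snd.
  apply=> [j|]; last exact: measurable_snd.
  by exact: measurableT_comp.
have nullM : {ae P, forall w, D (xsection (M1 `\` M0) w) = 0}.
  apply: (law_ae (mf := mid1) (Q := fun w => D (xsection (M1 `\` M0) w) = 0)).
  apply: product_null_section M10.
  exact: measurableD.
(* the second coordinate only serves for the later draws, so that for a fixed
   first one it makes them independent of the error set that they must avoid *)
pose Bad : set (Om1 * Om2) := [set p | 0 < D (xsection M0 p.1)] `&`
  \bigcap_(j in [set j | (N <= j)%N])
    (fun p : Om1 * Om2 => (p.1, Z j p.2)) @^-1` (~` M0).
have mBad : measurable Bad.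
  apply: measurableI.
    have mf : measurable_fun setT (fun p : Om1 * Om2 => D (xsection M0 p.1)).
      apply: (measurableT_comp (f := D \o xsection M0)).
        exact: measurable_fun_xsection.
      exact: measurable_fst.
    rewrite -[X in measurable X]setTI.
    by apply: (@measurable_lte _ _ _ _ _ (fun=> 0)) => //; exact: measurable_cst.
  apply: bigcap_measurableType => j Nj; rewrite -[X in measurable X]setTI.
  have mg : measurable_fun setT (fun p : Om1 * Om2 => (p.1, Z j p.2)).
    apply: measurable_fun_pair => //.
    by apply: measurableT_comp => //; exact: measurable_RV_cylinders.
  by apply: mg => //; exact: measurableC.
have PBad : P [set w | Bad (w, w)] = 0.
  rewrite (indep_diagonal mid1 mid2 ind mBad).
  apply: integral0_eq => w _ /=.
  have [w0|w0] := ltP 0 (D (xsection M0 w)).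
    have mBw : d'.-measurable (xsection Bad w).
      by have := mid2 measurableT _ (measurable_xsection w mBad); rewrite setTI.
    change (P (xsection Bad w) = 0).
    apply: (subset_measure0 mBw _ _ (iid_avoid iidZ N (measurable_xsection w mM0) w0)).
    + apply: bigcap_measurableType => j _; apply: measurable_preimage_RV.
      by apply: measurableC; exact: measurable_xsection.
    + move=> w' /xsectionP[_ Bw'] j Nj /= M0j; apply: (Bw' j Nj).
      by move: M0j => /xsectionP.
  rewrite (_ : xsection Bad w = set0) ?measure0//.
  apply/seteqP; split=> // w' /xsectionP[/=].
  by rewrite ltNge w0.
have nBad : {ae P, forall w, ~ Bad (w, w)}.
  exists [set w | Bad (w, w)]; split=> //; last by move=> w /= /contrapT.
  have mdiag := measurable_fun_pair mid1 mid2.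
  by have := mdiag measurableT _ mBad; rewrite setTI.
have aeP : Filter (almost_everywhere P) by exact: ae_filter_ringOfSetsType.
apply: filterS2 nullM nBad => w null_w nBad_w correct.
have D0 : D (xsection M0 w) = 0.
  apply/eqP; rewrite eq_le measure_ge0 andbT leNgt; apply/negP => D0.
  apply: nBad_w; split=> // j Nj /= /M0M; rewrite /M /= correct//.
  by rewrite eqxx.
apply/eqP; rewrite eq_le mu_ext_ge0 // andbT.
apply: (@le_trans _ _ (D (xsection M0 w `|` xsection (M1 `\` M0) w))).
  apply: outer_le_measure.
    by apply: measurableU; apply: measurable_xsection => //; exact: measurableD.
  move=> z Mz; have /MM1 : M (w, z) by [].
  have [M0z|nM0z] := pselect (M0 (w, z)); first by left; apply/xsectionP.
  by right; apply/xsectionP.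
apply: le_trans (measureU2 _ _ _) _.
- exact: measurable_xsection.
- by apply: measurable_xsection; exact: measurableD.
by rewrite [X in X + _]D0 [X in _ + X]null_w adde0.
Qed.

End SOA_PEC.

Lemma SOA_PEC_learner (R : realType) d (X : measurableType d) (H : set (X -> bool)) :
  measurability_assumption R H -> bounded_trees H -> PEC_learner R H (SOA R H).
Proof.
move=> hH bH D realD d' Om P Z iidZ.
have correct_ae : {ae P, forall w N c,
    let js := odflt [::] (unpickle c : option (seq nat)) in
    (forall j, (N <= j)%N -> chosen_hyp H Z N js w (Z j w).1 = (Z j w).2) ->
    loss D (chosen_hyp H Z N js w) = 0%E}.
  by apply: ae_foralln => N; apply: ae_foralln => c; exact: SOA_hyp_correct_ae.
have aeP : Filter (almost_everywhere P) by exact: ae_filter_ringOfSetsType.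
apply: filterS2 (realizable_ae iidZ realD) correct_ae => w real_w correct_w.
have [k maxk] := bH.
have [N stabN] := SOA_eventually R maxk real_w.
exists N => n Nn; rewrite /SOA; have [-> _] := stabN n Nn.
have [js jsN ejs] := SOA_state_map R H (fun i => Z i w) N.
have := correct_w N (pickle js); rewrite pickleK /=.
have -> : chosen_hyp H Z N js w =
    SOA_hyp R H (SOA_state R H (mkseq (fun i => Z i w) N)).
  rewrite /chosen_hyp; congr (SOA_hyp R H _).
  rewrite ejs -[js in RHS](mkseq_nth 0%N) -map_comp.
  apply/eq_in_map => i; rewrite mem_iota /= add0n /chosen => lt_i.
  by have /= -> := allP jsN _ (mem_nth 0%N lt_i).
by apply=> j Nj; have [] := stabN j Nj.
Qed.

(** * Independent uniform draws from a finite list *)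

Definition uniform01 (R : realType) : probability (measurableTypeR R) R :=
  [the probability _ _ of uniform_prob (@ltr01 R)].

Section Digits.
Local Open Scope ereal_scope.
Context (R : realType) (m : nat).
Hypothesis m0 : (0 < m)%N.

Notation Om := (measurableTypeR R).
Notation P := (uniform01 R).

Lemma uniform_prob01_itvco (a b : R) : (0 <= a)%R -> (a <= b)%R -> (b <= 1)%R ->
  P [set` `[a, b[%R] = (b - a)%:E.
Proof.
move=> a0 ab b1.
have sub01 : [set` `[a, b[%R] `<=` [set` `[0%R, 1%R]].
  move=> x /=; rewrite !in_itv /= => /andP[ax xb].
  by rewrite (le_trans a0 ax) (le_trans (ltW xb) b1).
change (uniform_prob (@ltr01 R) [set` `[a, b[%R] = (b - a)%:E).
rewrite /uniform_prob integral_uniform_pdf setIidl//.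
rewrite (eq_integral (cst 1)); last first.
  move=> x /set_mem /sub01; rewrite /= in_itv /= /uniform_pdf => -> /=.
  by rewrite subr0 invr1.
rewrite integral_cst//= mul1e lebesgue_measure_itv /= lte_fin.
case: ltP => // ba; rewrite (_ : a = b) ?subrr//.
by apply/eqP; rewrite eq_le ab ba.
Qed.

(** The number written by the first [n] digits of [w] in base [m]. *)
Definition prefix_num (n : nat) (w : R) : nat := Num.truncn (w * m%:R ^+ n).
Definition digit (n : nat) (w : R) : nat := (prefix_num n.+1 w %% m)%N.

Lemma measurable_prefix_num n : measurable_fun setT (prefix_num n : Om -> nat).
Proof.
have mlt j : measurable [set w : Om | (prefix_num n w <= j)%N].
  rewrite (_ : [set _ | _] = (fun w : R => (w * m%:R ^+ n)%R) @^-1` [set` `]-oo, j.+1%:R[%R]).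
    rewrite -[X in measurable X]setTI; apply: measurable_funM => //.
  apply/seteqP; split=> w /=; rewrite in_itv /= /prefix_num real_truncn_le_nat//;
    exact: num_real.
move=> _ A _; rewrite setTI.
rewrite (_ : _ @^-1` A = \bigcup_(j in A)
   ([set w : Om | (prefix_num n w <= j)%N] `\`
     \bigcup_(i in [set i | (i < j)%N]) [set w : Om | (prefix_num n w <= i)%N])).
  apply: bigcup_measurable => j _; apply: measurableD => //.
  by apply: bigcup_measurable.
apply/seteqP; split=> w /=.
  move=> Aw; exists (prefix_num n w) => //; split=> //= -[i /=].
  by rewrite ltnNge => /negbTE ->.
move=> [j Aj [/= wj nw]]; suff -> : prefix_num n w = j by [].
apply/eqP; rewrite eqn_leq wj leqNgt; apply/negP => lt_wj; apply: nw.
by exists (prefix_num n w); [exact: lt_wj|exact: leqnn].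
Qed.

Lemma measurable_digit n (B : set nat) : measurable ((digit n : Om -> nat) @^-1` B).
Proof.
rewrite -[X in measurable X]setTI.
exact: (measurable_prefix_num n.+1 measurableT (Y := [set k | B (k %% m)%N])).
Qed.

Let W : set Om := [set` `[0%R, 1%R[].

Lemma prefix_numS n (w : R) : (0 <= w)%R ->
  (prefix_num n.+1 w %/ m)%N = prefix_num n w.
Proof.
move=> w0; have mR : (0 < m%:R :> R)%R by rewrite ltr0n.
have c0 : (0 <= w * m%:R ^+ n)%R by rewrite mulr_ge0 ?exprn_ge0.
have cS0 : (0 <= w * m%:R ^+ n.+1)%R by rewrite mulr_ge0 ?exprn_ge0.
have /andP[lo hi] := truncn_itv c0.
apply/esym/eqP; rewrite eqn_leq; apply/andP; split.
  rewrite leq_divRL// /prefix_num truncn_ge_nat// exprSr mulrA natrM.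
  by rewrite ler_pM2r.
rewrite -ltnS ltn_divLR// /prefix_num truncn_lt_nat// exprSr mulrA natrM.
by rewrite ltr_pM2r.
Qed.

Lemma prob_prefix_num n j : (j < m ^ n)%N ->
  P (W `&` [set w | prefix_num n w = j]) = (m%:R ^- n)%:E.
Proof.
move=> jn; have mR : (0 < m%:R ^+ n :> R)%R by rewrite exprn_gt0 ?ltr0n.
rewrite (_ : _ `&` _ = [set` `[(j%:R / m%:R ^+ n)%R, (j.+1%:R / m%:R ^+ n)%R[]).
  rewrite uniform_prob01_itvco.
  - by rewrite -mulrBl -addn1 natrD addrAC subrr add0r mul1r.
  - by rewrite divr_ge0// ltW.
  - by rewrite ler_pM2r ?invr_gt0// ler_nat.
  - by rewrite ler_pdivrMr// mul1r -natrX ler_nat.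
apply/seteqP; split=> w /=; rewrite !in_itv /= ler_pdivrMr// ltr_pdivlMr//.
  move=> [/andP[w0 w1] <-]; apply: truncn_itv.
  by rewrite mulr_ge0// ltW.
move=> /andP[jw wj].
have w0 : (0 <= w)%R by rewrite -(pmulr_lge0 _ mR) (le_trans _ jw).
split; last by apply: truncn_def; rewrite jw wj.
rewrite /W /= in_itv /= w0 -(ltr_pM2r mR) mul1r (lt_le_trans wj)//.
by rewrite -natrX ler_nat.
Qed.

Definition freq (A : set nat) : R := ((\sum_(a < m) `[< A a >]%:R) / m%:R)%R.

Lemma freqT : freq setT = 1%R.
Proof.
rewrite /freq (eq_bigr (fun=> 1%R)) => [|a _]; last by rewrite asboolT.
by rewrite sumr_const card_ord divff// pnatr_eq0 -lt0n.
Qed.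

Let block l k j (B : nat -> set nat) : set Om :=
  W `&` [set w | prefix_num k w = j] `&`
  \bigcap_(i in [set i | (i < l)%N]) digit (k + i) @^-1` B i.

Lemma measurable_block l k j B : measurable (block l k j B).
Proof.
apply: measurableI.
  apply: measurableI; first exact: measurable_itv.
  rewrite -[X in measurable X]setTI.
  exact: (measurable_prefix_num k measurableT (Y := [set j])).
by apply: bigcap_measurableType => i _; exact: measurable_digit.
Qed.

(** Conditioning on the first [k] digits leaves an interval of length [m ^- k],
which the next digit cuts into [m] equal parts. *)
Lemma prob_block l k j B : (j < m ^ k)%N ->
  P (block l k j B) = (m%:R ^- k * \prod_(i < l) freq (B i))%:E.
Proof.
elim: l k j B => [|l IH] k j B jk.
  rewrite big_ord0 mulr1 -(prob_prefix_num jk); congr (P _).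
  by rewrite /block (_ : \bigcap_(i in _) _ = setT) ?setIT//; apply/seteqP; split.
pose F a := if (a < m)%N && `[< B 0%N a >]
  then block l k.+1 (j * m + a) (fun i => B i.+1) else set0.
have mF a : measurable (F a).
  by rewrite /F; case: ifP => // _; exact: measurable_block.
have tF : trivIset setT F.
  move=> a b _ _ [w []]; rewrite /F; case: ifP => // _ [[_ /= ea] _].
  by case: ifP => // _ [[_ /=]]; rewrite ea => /eqP; rewrite eqn_add2l => /eqP.
have -> : block l.+1 k j B = \big[setU/set0]_(a < m) F a.
  rewrite -bigcup_mkord; apply/seteqP; split=> w.
    move=> [[Ww /= qj] Bw]; have w0 : (0 <= w)%R.
      by move: Ww; rewrite /W /= in_itv /= => /andP[].
    exists (digit k w); first by rewrite /= ltn_pmod.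
    rewrite /F ltn_pmod// asboolT /=; last by have := Bw 0%N isT; rewrite /= addn0.
    split; first split=> //=.
      by rewrite {1}(divn_eq (prefix_num k.+1 w) m) prefix_numS// qj.
    by move=> i /= il; have := Bw i.+1 il; rewrite /= addnS.
  move=> [a /= am]; rewrite /F am /=; case: asboolP => // Ba [[Ww /= qa] Bw].
  have w0 : (0 <= w)%R by move: Ww; rewrite /W /= in_itv /= => /andP[].
  split; first split=> //=.
    by rewrite -prefix_numS// qa divnMDl// divn_small// addn0.
  move=> [|i] /= il; last by have := Bw i il; rewrite /= addnS.
  by rewrite addn0 /digit qa modnMDl modn_small.
rewrite measure_bigsetU//.
rewrite (eq_bigr (fun a : 'I_m => (`[< B 0%N a >]%:R *
    (m%:R ^- k.+1 * \prod_(i < l) freq (B i.+1)))%:E)) => [|a _].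
  rewrite sumEFin -mulr_suml big_ord_recl; congr (_%:E).
  rewrite /freq exprSr invfM; ring.
rewrite /F ltn_ord /=; case: asboolP => Ba; last by rewrite measure0 mul0r.
rewrite mul1r IH// expnSr (@leq_trans (j * m + m))// ?ltn_add2l//.
by rewrite -mulSnr leq_pmul2r.
Qed.

Lemma prob_digits l (B : nat -> set nat) :
  P (\bigcap_(i in [set i | (i < l)%N]) digit i @^-1` B i) =
  (\prod_(i < l) freq (B i))%:E.
Proof.
set E := \bigcap_(i in _) _.
have mE : measurable E.
  by apply: bigcap_measurableType => i _; exact: measurable_digit.
have mW : measurable W by exact: measurable_itv.
have PW : P W = 1 by rewrite /W uniform_prob01_itvco// subr0.
have -> : P E = P (W `&` E).
  have PCW : P (~` W) = 0 by rewrite probability_setC// PW subee.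
  have mCW : measurable (~` W) by exact: measurableC.
  have mEW : measurable (E `&` W) by exact: measurableI.
  have mECW : measurable (E `&` ~` W) by exact: measurableI.
  have PECW : P (E `&` ~` W) = 0.
    exact: (@subset_measure0 _ _ _ P _ _ mECW mCW (@subIsetr _ _ _) PCW).
  rewrite -[in LHS](setIT E) -(setUv W) setIUr measureU//; last first.
    by rewrite setIACA setICr setI0.
  by rewrite [X in _ + X]PECW adde0 setIC.
have <- : block l 0 0 B = W `&` E.
  apply/seteqP; split=> [w [[Ww _] Ew]|w [Ww Ew]]; first by split.
  split=> //; split=> //=; move: Ww; rewrite /W /= in_itv /= => w01.
  by apply: truncn_def; rewrite expr0 mulr1.
by rewrite prob_block ?expn0// expr0 invr1 mul1r.
Qed.

End Digits.

Section UniformDraws.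
Local Open Scope ereal_scope.
Context (R : realType) d (T : measurableType d) (zs : seq T).
Hypothesis zs0 : (0 < size zs)%N.

Notation Om := (measurableTypeR R).
Notation P := (uniform01 R).

Definition draw_fun (n : nat) (w : Om) : T := nth point zs (digit (size zs) n w).

Lemma draw_fun_preimage n B :
  draw_fun n @^-1` B = digit (size zs) n @^-1` [set a | B (nth point zs a)].
Proof. by []. Qed.

Lemma measurable_draw_fun n : measurable_fun setT (draw_fun n).
Proof. by move=> _ B _; rewrite setTI draw_fun_preimage; exact: measurable_digit. Qed.

Definition draw (n : nat) : {RV P >-> T} := mfun_Sub (mem_set (measurable_draw_fun n)).

Lemma drawE n w : draw n w = nth point zs (digit (size zs) n w).
Proof. by []. Qed.

Lemma draw_mem n w : draw n w \in zs.
Proof. by rewrite drawE mem_nth// ltn_pmod. Qed.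

Let fr (B : set T) : R := freq R (size zs) [set a | B (nth point zs a)].

Lemma prob_draws l (B : nat -> set T) :
  P (\bigcap_(i in [set i | (i < l)%N]) draw i @^-1` B i) =
  (\prod_(i < l) fr (B i))%:E.
Proof. exact: (prob_digits R zs0 l (fun i => [set a | B i (nth point zs a)])). Qed.

Lemma prob_draw n (B : set T) : P (draw n @^-1` B) = (fr B)%:E.
Proof.
have := prob_draws n.+1 (fun i => if i == n then B else setT).
rewrite big_ord_recr /= eqxx big1 => [|i _]; last first.
  by rewrite ltn_eqF// /fr freqT.
rewrite mul1r => <-; congr (P _); apply/seteqP; split=> w.
  by move=> Bw i /= _; case: eqP => // ->.
by move=> /(_ n (ltnSn n)); rewrite /= eqxx.
Qed.

Lemma iid_draw : iid (distribution P (draw 0)) draw.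
Proof.
split=> [n B mB|J B uJ mB].
  by transitivity ((fr B)%:E); [exact: prob_draw|exact/esym/prob_draw].
have [l Jl] : exists l, forall i, i \in J -> (i < l)%N.
  by exists (\max_(i <- J) i).+1 => i iJ; rewrite ltnS; exact: leq_bigmax_seq.
pose B' i := if i \in J then B i else setT.
transitivity (P (\bigcap_(i in [set i | (i < l)%N]) draw i @^-1` B' i)).
  congr (P _); apply/seteqP; split=> w Bw i /=.
    by move=> _; rewrite /B'; case: ifP => // iJ; exact: Bw.
  by move=> iJ; have := Bw i (Jl i iJ); rewrite /B' /= iJ.
rewrite prob_draws (eq_bigr (fun i => (fr (B i))%:E)) => [|i _]; last exact: prob_draw.
rewrite prodEFin; congr (_%:E).
rewrite -(big_mkord xpredT (fun i => fr (B' i))) /index_iota subn0.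
rewrite (bigID (mem J)) /= [X in (_ * X)%R]big1 ?mulr1 => [|i /negPf iJ]; last first.
  by rewrite /B' iJ /fr freqT.
rewrite -big_filter.
rewrite (perm_big J) /=; last first.
  apply: uniq_perm; rewrite ?filter_uniq ?iota_uniq// => i.
  rewrite mem_filter mem_iota add0n /=; case: (boolP (i \in J)) => //= /Jl ->//.
by apply: eq_big_seq => i iJ; rewrite /B' iJ.
Qed.

Lemma fr_gt0 (B : set T) z : z \in zs -> B z -> (0 < fr B)%R.
Proof.
move=> zzs Bz; rewrite /fr /freq divr_gt0 ?ltr0n//.
have lt_i : (index z zs < size zs)%N by rewrite index_mem.
rewrite (bigD1 (Ordinal lt_i)) //= ltr_wpDr ?sumr_ge0//.
by rewrite nth_index// asboolT.
Qed.

(** Every finite word over the support is drawn with positive probability, so an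
almost sure property has a witness that starts with a prescribed word. *)
Lemma draw_prefix (s : seq T) (Q : set Om) : {subset s <= zs} ->
  {ae P, forall w, Q w} -> exists2 w, Q w & mkseq (fun i => draw i w) (size s) = s.
Proof.
move=> szs [A [mA PA QA]].
pose E := \bigcap_(i in [set i | (i < size s)%N]) draw i @^-1` [set nth point s i].
have PE : 0 < P E.
  rewrite prob_draws lte_fin prodr_gt0// => i _.
  by apply: (@fr_gt0 _ (nth point s i)) => //; apply/szs/mem_nth.
have [w Ew nAw] : exists2 w, E w & ~ A w.
  apply: contrapT => no; suff : P E <= 0 by rewrite leNgt PE.
  rewrite -PA; apply: le_measure; rewrite ?inE//.
    apply: bigcap_measurableType => i _.
    by rewrite /= draw_fun_preimage; exact: measurable_digit.
  by move=> w Ew; apply: contrapT => nAw; apply: no; exists w.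
exists w; first by apply: contrapT => nQ; apply/nAw/QA.
apply: (@eq_from_nth _ point); rewrite size_mkseq// => i i_s.
by rewrite nth_mkseq//; have := Ew i i_s.
Qed.

End UniformDraws.

(** * Stable learners only exist for Littlestone classes *)

Section FiniteSupport.
Local Open Scope ereal_scope.
Context (R : realType) d (X : measurableType d) (H : set (X -> bool)).
Hypothesis hH : measurability_assumption R H.
Variable zs : seq (X * bool).
Hypothesis zs0 : (0 < size zs)%N.

Let D : probability (X * bool)%type R := distribution (uniform01 R) (draw R zs 0).

Lemma loss0_consistent (h : X -> bool) : loss D h = 0 -> consistent h zs.
Proof.
move=> loss0; apply/allP => z zzs; apply/negPn/negP => hz.
have [B [mB errB DB]] := outer_hull D [set z | h z.1 != z.2].
have PB : 0 < uniform01 R (draw R zs 0 @^-1` B).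
  by rewrite (prob_draw R zs0) lte_fin; apply: (fr_gt0 R zs0 zzs); exact: errB.
have : 0 < D B by exact: PB.
by rewrite [ltRHS]DB [ltRHS]loss0 ltxx.
Qed.

Lemma consistent_loss0 (h : X -> bool) : consistent h zs -> loss D h = 0.
Proof.
move=> /allP hzs; apply/eqP; rewrite eq_le mu_ext_ge0 // andbT.
have mzs : measurable [set` zs].
  rewrite (_ : [set` zs] = \bigcup_(i in `I_(size zs)) [set nth point zs i]).
    apply: bigcup_measurable => i _; exact: (measurability_assumption_set1 hH).
  apply/seteqP; split=> z /=.
    by move=> zzs; exists (index z zs); rewrite /= ?index_mem// nth_index.
  by move=> [i /= izs ->]; exact: mem_nth.
apply: (@le_trans _ _ (D (~` [set` zs]))).
  apply: outer_le_measure; first exact: measurableC.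
  by move=> z /= hz zzs; rewrite hzs in hz.
have noescape : draw R zs 0 @^-1` (~` [set` zs]) = set0.
  by apply/seteqP; split=> w //=; apply; exact: draw_mem.
change (uniform01 R (draw R zs 0 @^-1` (~` [set` zs])) <= 0).
by rewrite noescape measure0.
Qed.

Lemma consistent_realizable (h : X -> bool) : H h -> consistent h zs ->
  realizable H D.
Proof.
move=> Hh hzs; apply/eqP; rewrite eq_le; apply/andP; split.
  by apply: ereal_inf_lbound; exists h => //; exact: consistent_loss0.
by apply: le_ereal_inf_tmp => _ [g _ <-]; exact: mu_ext_ge0.
Qed.

(** With finite support, zero loss means being right on every example, and a
correct moment of the learner can be awaited from any prefix. *)
Lemma PEC_extend (A : learning_rule X) (h : X -> bool) (s : seq (X * bool)) :
  PEC_learner R H A -> H h -> consistent h zs -> {subset s <= zs} ->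
  exists2 r, {subset s ++ r <= zs} & consistent (A (s ++ r)) zs.
Proof.
move=> pecA Hh hzs szs.
have /(draw_prefix zs0 szs)[w [N lossN] ws] :=
  pecA D (consistent_realizable Hh hzs) _ _ _ _ (iid_draw R zs0).
set z := fun i => _ in lossN ws.
have e : s ++ drop (size s) (mkseq z (maxn N (size s))) = mkseq z (maxn N (size s)).
  rewrite -[RHS](cat_take_drop (size s)) -{1}ws; congr (_ ++ _).
  by rewrite /mkseq -map_take take_iota (minn_idPl _)// leq_maxr.
exists (drop (size s) (mkseq z (maxn N (size s)))); rewrite e.
  by move=> _ /mapP[i _ ->]; exact: draw_mem.
by apply: loss0_consistent; apply: lossN; exact: leq_maxl.
Qed.

End FiniteSupport.

Section StableBounded.
Context (R : realType) d (X : measurableType d) (H : set (X -> bool)).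
Hypothesis hH : measurability_assumption R H.
Variable A : learning_rule X.
Hypothesis pecA : PEC_learner R H A.

(** The adversary walks down the tree: at each node it waits, with the examples
shown so far, until the learner is right on all of them, and it then reveals at
the next node the label that the current hypothesis gets wrong. *)
Lemma force_mind_changes t (zs s : seq (X * bool)) :
  {subset s <= zs} -> shatters_depth (version_space H zs) t ->
  exists zs' s' h, [/\ {subset s' <= zs'}, H h, consistent h zs',
    (size zs + t <= size zs')%N & (num_changes A s + t <= num_changes A s')%N].
Proof.
elim: t zs s => [|t IH] zs s szs.
  by move=> /shatters_depth0[h [Hh hzs]]; exists zs, s, h; rewrite !addn0.
move=> /shatters_depth_rconsS[x shx].
pose zs1 := rcons zs (x, ~~ A s x).
have zs10 : (0 < size zs1)%N by rewrite size_rcons.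
have szs1 : {subset s <= zs1}.
  by move=> z /szs zzs; rewrite mem_rcons inE zzs orbT.
have sh1 : shatters_depth (version_space H zs1) t by exact: shx.
have [h [Hh hzs1]] : exists h, version_space H zs1 h.
  exact/shatters_depth0/(leq_shatters_depth (leq0n t)).
have [r rzs1 Ar] := PEC_extend hH zs10 pecA Hh hzs1 szs1.
have lt_r : (num_changes A s < num_changes A (s ++ r))%N.
  apply: ltn_num_changes_cat => e; move: Ar; rewrite consistent_rcons /= -e.
  by case: (A s x); rewrite /= andbF.
have [zs' [s' [h' [s'zs' Hh' h'zs' le_zs' le_s']]]] := IH zs1 (s ++ r) rzs1 sh1.
exists zs', s', h'; split=> //; first by rewrite -addSnnS -(size_rcons zs (x, ~~ A s x)).
by rewrite addnS -addSn (leq_trans _ le_s')// leq_add2r.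
Qed.

Lemma stable_PEC_bounded k :
  (forall D : probability (X * bool)%type R, realizable H D ->
    forall (d' : measure_display) (Om : measurableType d')
      (P : probability Om R) (Z : nat -> {RV P >-> (X * bool)%type}), iid D Z ->
    {ae P, forall w, (mind_changes A (fun i => Z i w) #<= `I_k)%card}) ->
  forall t, shatters_depth H t -> (t <= k)%N.
Proof.
move=> stableA t sht; rewrite leqNgt; apply/negP => lt_kt.
have sh : shatters_depth (version_space H [::]) t by rewrite version_space_nil.
have [|zs [s [h [szs Hh hzs le_zs le_s]]]] := @force_mind_changes t [::] [::] _ sh.
  by [].
have zs0 : (0 < size zs)%N by apply: leq_trans le_zs; exact: leq_trans lt_kt.
have real := consistent_realizable hH zs0 Hh hzs.
have [w mc ws] := draw_prefix zs0 szs (stableA _ real _ _ _ _ (iid_draw R zs0)).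
have := num_changes_mind_changes (size s) mc; rewrite ws leqNgt => /negP; apply.
by apply: leq_trans lt_kt (leq_trans _ le_s); exact: leq_addl.
Qed.

End StableBounded.

Theorem theorem8 (R : realType) (d : measure_display) (X : measurableType d)
    (H : set (X -> bool)) (hH : measurability_assumption R H) :
  (stably_PEC_learnable R H <-> bounded_trees H) /\
  (bounded_trees H <-> littlestone_class R H) /\
  (bounded_trees H ->
     PEC_learner R H (SOA R H) /\
     forall z : nat -> X * bool, realizable_seq H z ->
       exists2 k : nat, Ldim R H = (k%:R)%:E &
         (mind_changes (SOA R H) z #<= `I_k)%card).
Proof.
split; [split|split; [|move=> bH; split]].
- by move=> [A [k [pecA stableA]]]; exists k; exact: stable_PEC_bounded stableA.
- move=> bH; have [k maxk] := bH; exists (SOA R H), k; split.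
    exact: SOA_PEC_learner.
  move=> D realD d' Om P Z iidZ.
  have aeP : Filter (almost_everywhere P) by exact: ae_filter_ringOfSetsType.
  by apply: filterS (realizable_ae iidZ realD) => w; exact: mind_changes_SOA.
- by split=> /(littlestone_classP R).
- exact: SOA_PEC_learner.
move=> z rz; have [h Hh _] := rz 0%N.
have [k eL maxk] := Ldim_fin R bH (ex_intro _ h Hh).
by exists k => //; exact: mind_changes_SOA.
Qed.
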